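(* Let $m\ge 1$ be an integer. Then each of the seven quadratic sums $$\sum_{n=1}^\infty \frac{L_n^2(1)}{n^{2m}}(-1)^{n-1},\quad \sum_{n=1}^\infty \frac{H_nL_n(1)}{n^{2m}},\quad \sum_{n=1}^\infty \frac{H_nL_n(1)}{n^{2m}}(-1)^{n-1},\quad \sum_{n=1}^\infty \frac{H_n^2}{n^{2m}},$$ $$\sum_{n=1}^\infty \frac{H_n^2}{n^{2m}}(-1)^{n-1},\quad \sum_{n=1}^\infty \frac{L_n^2(1)}{n^{2m}},\quad \sum_{n=1}^\infty \frac{H_n^2}{(2n+1)^{2m}}$$ is reducible to linear sums (and zeta values), i.e. it can be written as a polynomial with rational coefficients in $\ln 2$, the zeta values $\zeta(k)$ ($k\ge 2$ an integer), and the linear Euler sums $$\sum_{n=1}^\infty \frac{\zeta_n(p)}{n^q},\quad \sum_{n=1}^\infty \frac{L_n(p)}{n^q},\quad \sum_{n=1}^\infty \frac{\zeta_n(p)}{n^q}(-1)^{n-1},\quad \sum_{n=1}^\infty \frac{L_n(p)}{n^q}(-1)^{n-1}\qquad (p\ge 1,\ q\ge 2 \text{ integers}).$$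
   Context: For integers $n,k\ge1$: $H_n=\sum_{j=1}^n \frac1j$, $\zeta_n(k)=\sum_{j=1}^n \frac1{j^k}$, $L_n(k)=\sum_{j=1}^n \frac{(-1)^{j-1}}{j^k}$. Here $\zeta$ is the Riemann zeta function. *)

(* Defs.v *)
From mathcomp Require Import all_boot all_order all_algebra.
From mathcomp Require Import all_classical all_reals all_analysis.
(* mpoly is not imported: its notations clash with those of the analysis
   library. *)
From mathcomp Require mpoly.

Set Implicit Arguments.
Unset Strict Implicit.
Unset Printing Implicit Defensive.

Import Order.TTheory GRing.Theory Num.Theory.
Import numFieldNormedType.Exports.

Local Open Scope classical_set_scope.
Local Open Scope ring_scope.

Definition zeta_partial {R : realType} (n k : nat) : R :=
  \sum_(1 <= j < n.+1) 1 / j%:R ^+ k.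

Definition harmonic_number {R : realType} (n : nat) : R :=
  \sum_(1 <= j < n.+1) 1 / j%:R.

Definition alt_partial {R : realType} (n k : nat) : R :=
  \sum_(1 <= j < n.+1) (-1) ^+ j.-1 / j%:R ^+ k.

Definition infinite_sum {R : realType} (a : nat -> R) : R :=
  limn (fun N => \sum_(1 <= n < N) a n).

(* Only used at integers k >= 2, where the Dirichlet series converges. *)
Definition zeta {R : realType} (k : nat) : R :=
  infinite_sum (fun n => 1 / n%:R ^+ k).

Inductive linear_constant {R : realType} : R -> Prop :=
| LCln2 : linear_constant (ln 2)
| LCzeta k : (2 <= k)%N -> linear_constant (zeta k)
| LCzeta_sum p q : (1 <= p)%N -> (2 <= q)%N ->
    linear_constant (infinite_sum (fun n => zeta_partial n p / n%:R ^+ q))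
| LCalt_sum p q : (1 <= p)%N -> (2 <= q)%N ->
    linear_constant (infinite_sum (fun n => alt_partial n p / n%:R ^+ q))
| LCzeta_altsum p q : (1 <= p)%N -> (2 <= q)%N ->
    linear_constant
      (infinite_sum (fun n => zeta_partial n p / n%:R ^+ q * (-1) ^+ n.-1))
| LCalt_altsum p q : (1 <= p)%N -> (2 <= q)%N ->
    linear_constant
      (infinite_sum (fun n => alt_partial n p / n%:R ^+ q * (-1) ^+ n.-1)).

Definition reducible_to_linear {R : realType} (x : R) : Prop :=
  exists (d : nat) (P : mpoly.mpoly d rat) (c : 'I_d -> R),
    (forall i, linear_constant (c i)) /\ x = mpoly.mmap ratr c P.

(* Infinite sums are limits with a default value when divergent, so convergence
   is asserted explicitly. *)
Definition reducible_series {R : realType} (a : nat -> R) : Prop :=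
  cvgn (fun N => \sum_(1 <= n < N) a n) /\
  reducible_to_linear (infinite_sum a).

(* Main.v *)
(* The parity of the exponent enters through
   two-sided sums. Put Q_t(x) = sum_(l >= 1) t^l / (l (x - l)) with t = 1 or -1,
   the singular term being omitted when x is a positive integer. Then k Q_t(k)
   and - k Q_t(-k) are both, up to elementary terms, H_k for t = 1 and
   (-1)^k (ln 2 - L_k(1)) - ln 2 for t = -1; hence for e even
     sum_(n <> 0) r^|n| n^-e Q_s(n) Q_t(n)
   is twice a quadratic sum of exponent e + 2 plus linear sums. On the other
   hand, expanding Q_s(n) Q_t(n) as a double sum over k, l and splitting
   1 / ((n - k) (n - l)) into partial fractions, the summation over n can be
   performed first: the sums over n <> 0 of r^|n| n^-e (n - k)^-b, b = 1, 2, are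
   elementary functions of k with zeta values as coefficients, so that only
   linear sums remain. The rearrangement is carried out on sums truncated at N,
   where it is a finite identity, and each side passes to the limit by Tannery's
   theorem with a majorant C H_k^2 / k^2. *)
Require Import Defs.
From mathcomp Require Import all_boot all_order all_algebra.
From mathcomp Require Import all_classical all_reals all_analysis.
From mathcomp Require Import ring lra.
From mathcomp Require mpoly.
Import (canonicals) mpoly.

Set Implicit Arguments.
Unset Strict Implicit.
Unset Printing Implicit Defensive.

Import Order.TTheory GRing.Theory Num.Theory.
Import numFieldNormedType.Exports.

Local Open Scope classical_set_scope.
Local Open Scope ring_scope.

(** * The ring of reducible constants *)

Section Reducible.
Variable R : realType.
Implicit Types x y : R.

(** The renamed polynomial is built along the induction on monomials. It lets two polynomials be
    evaluated on one common family of constants. *)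
Lemma mmap_rename (d e : nat) (c : 'I_e -> R) (h : 'I_d -> 'I_e)
    (P : mpoly.mpoly d rat) :
  exists Q : mpoly.mpoly e rat,
    mpoly.mmap ratr (c \o h) P = mpoly.mmap ratr c Q.
Proof.
elim/mpoly.mpolyind: P => [|a m p _ _ [Q hQ]].
  by exists 0; rewrite !mpoly.mmap0.
exists (mpoly.mpolyC e a *
  \prod_i mpoly.mpolyX rat (mpoly.mnm1 (h i)) ^+ mpoly.fun_of_multinom m i + Q).
rewrite !mpoly.mmapD hQ mpoly.mmapZ mpoly.mmapX; congr (_ + _).
rewrite rmorphM /= mpoly.mmapC rmorph_prod /=; congr (_ * _).
by apply: eq_bigr => i _; rewrite rmorphXn /= mpoly.mmapX mpoly.mmap1U.
Qed.

(** The two families of constants are concatenated, and each polynomial is renamed into its own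
    block of variables. *)
Lemma reducible_common x y : reducible_to_linear x -> reducible_to_linear y ->
  exists (d : nat) (c : 'I_d -> R) (P Q : mpoly.mpoly d rat),
    [/\ forall i, linear_constant (c i), x = mpoly.mmap ratr c P
      & y = mpoly.mmap ratr c Q].
Proof.
move=> [d [P [c [hc ->]]]] [e [Q [c' [hc' ->]]]].
pose f (i : 'I_(d + e)) := match fintype.split i with inl j => c j | inr j => c' j end.
have [P' hP] := mmap_rename f (@lshift d e) P.
have [Q' hQ] := mmap_rename f (@rshift d e) Q.
exists (d + e)%N, f, P', Q'; split.
- by move=> i; rewrite /f; case: (fintype.split i).
- rewrite -hP; congr (mpoly.mmap _ _ _); apply/funext => i /=.
  by rewrite /f -[lshift _ _]/(unsplit (inl i)) unsplitK.
- rewrite -hQ; congr (mpoly.mmap _ _ _); apply/funext => i /=.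
  by rewrite /f -[rshift _ _]/(unsplit (inr i)) unsplitK.
Qed.

Lemma reducibleD x y : reducible_to_linear x -> reducible_to_linear y ->
  reducible_to_linear (x + y).
Proof.
move=> hx hy; have [d [c [P [Q [hc -> ->]]]]] := reducible_common hx hy.
by exists d, (P + Q), c; rewrite mpoly.mmapD.
Qed.

Lemma reducibleM x y : reducible_to_linear x -> reducible_to_linear y ->
  reducible_to_linear (x * y).
Proof.
move=> hx hy; have [d [c [P [Q [hc -> ->]]]]] := reducible_common hx hy.
by exists d, (P * Q), c; rewrite rmorphM.
Qed.

Lemma reducible_ratr (a : rat) : reducible_to_linear (ratr a : R).
Proof.
exists 0%N, (mpoly.mpolyC 0 a), (fun=> 0).
by rewrite mpoly.mmapC; split=> // -[].
Qed.

Lemma reducible_linear x : linear_constant x -> reducible_to_linear x.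
Proof.
move=> hx; exists 1%N, (mpoly.mpolyX rat (mpoly.mnm1 ord0)), (fun=> x).
by rewrite mpoly.mmapX mpoly.mmap1U.
Qed.

Lemma reducible_int (z : int) : reducible_to_linear (z%:~R : R).
Proof. by rewrite -[_%:~R]ratr_int; exact: reducible_ratr. Qed.

Lemma reducible_inv2 : reducible_to_linear (2^-1 : R).
Proof. by rewrite -[2]/(2%:R) -ratr_nat -fmorphV; exact: reducible_ratr. Qed.

Lemma reducibleN x : reducible_to_linear x -> reducible_to_linear (- x).
Proof. by move=> hx; rewrite -mulN1r; apply/reducibleM/hx/(reducible_int (-1)). Qed.

End Reducible.


(** * Tannery's theorem *)

Section Tannery.
Variable R : realType.
Implicit Types (a b g : nat -> R) (f : nat -> nat -> R).

Lemma bounded_ge0_cvgn b (M : R) :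
  (forall k, (0 < k)%N -> 0 <= b k) ->
  (forall N, \sum_(1 <= k < N.+1) b k <= M) ->
  cvgn (fun N => \sum_(1 <= k < N) b k).
Proof.
move=> b0 bM; apply: nondecreasing_is_cvgn; last first.
  exists (Num.max 0 M) => _ [[|N] _ <-].
    by rewrite big_geq // le_max lexx.
  by rewrite le_max bM orbT.
apply/nondecreasing_seqP => -[|N]; first by rewrite !big_geq.
by rewrite [leRHS]big_nat_recr //= lerDl b0.
Qed.

(** [g + b] is nonnegative with partial sums at most [2 M], so [g] is a difference of two convergent
    series of nonnegative terms. *)
Lemma dominated_cvgn g b (M : R) :
  (forall k, (0 < k)%N -> `|g k| <= b k) ->
  (forall N, \sum_(1 <= k < N.+1) b k <= M) ->
  cvgn (fun N => \sum_(1 <= k < N) g k).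
Proof.
move=> gb bM.
have b0 k : (0 < k)%N -> 0 <= b k by move=> /gb; exact: le_trans.
have gbM N : \sum_(1 <= k < N.+1) (g k + b k) <= M + M.
  rewrite big_split lerD // (le_trans _ (bM N))//; apply: ler_sum_nat => k /andP[k0 _].
  exact: le_trans (ler_norm _) (gb _ k0).
have cb := bounded_ge0_cvgn b0 bM.
have cgb : cvgn (fun N => \sum_(1 <= k < N) (g k + b k)).
  apply: bounded_ge0_cvgn gbM => k k0.
  by have := gb _ k0; rewrite ler_norml => /andP[+ _]; lra.
have -> : (fun N => \sum_(1 <= k < N) g k) =
    (fun N => \sum_(1 <= k < N) (g k + b k)) - (fun N => \sum_(1 <= k < N) b k).
  apply/funext => N.
  by rewrite -[RHS]/(_ - _) -sumrB; apply: eq_bigr => k _; rewrite addrK.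
exact: is_cvgB.
Qed.

Lemma infinite_sumP a : cvgn (fun N => \sum_(1 <= k < N) a k) ->
  \sum_(1 <= k < N) a k @[N --> \oo] --> infinite_sum a.
Proof. by []. Qed.

Lemma infinite_sum_eq a (l : R) : \sum_(1 <= k < N) a k @[N --> \oo] --> l ->
  infinite_sum a = l.
Proof. by move=> al; apply/cvg_lim. Qed.

Lemma cvgn_sum_nat f g K : (forall k, (0 < k)%N -> f^~ k @ \oo --> g k) ->
  \sum_(1 <= k < K) f N k @[N --> \oo] --> \sum_(1 <= k < K) g k.
Proof.
move=> fg; elim: K => [|[|K] IH].
- rewrite big_geq //; under eq_fun do rewrite big_geq //; exact: cvg_cst.
- rewrite big_geq //; under eq_fun do rewrite big_geq //; exact: cvg_cst.
rewrite big_nat_recr //=; under eq_fun do rewrite big_nat_recr //=.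
exact: cvgD IH (fg _ _).
Qed.

Lemma cvgn_le_norm (u : nat -> R) (l c : R) (K : nat) : u @ \oo --> l ->
  (forall N, (K <= N)%N -> `|u N| <= c) -> `|l| <= c.
Proof.
move=> ul uc; have nl : `|u N| @[N --> \oo] --> `|l| by exact: cvg_norm.
apply: (cvgr_to_le nl); near=> N; apply: uc; near: N; exact: nbhs_infty_ge.
Unshelve. all: by end_near. Qed.

(** The range of summation grows with [N] as well, so the majorant is asked only for [k <= N]. A
    fixed head converges term by term; the tail of [f N - g] is at most twice that of [b]. *)
Lemma tannery f g b (M : R) :
  (forall k, (0 < k)%N -> f^~ k @ \oo --> g k) ->
  (forall N k, (0 < k <= N)%N -> `|f N k| <= b k) ->
  (forall N, \sum_(1 <= k < N.+1) b k <= M) ->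
  cvgn (fun N => \sum_(1 <= k < N) g k) /\
  \sum_(1 <= k < N.+1) f N k @[N --> \oo] --> infinite_sum g.
Proof.
move=> fg fb bM.
have gb k : (0 < k)%N -> `|g k| <= b k.
  move=> k0; apply: (cvgn_le_norm (K := k) (fg k k0)) => N kN.
  by rewrite fb ?k0.
have cg := dominated_cvgn gb bM; split => //.
have b0 k : (0 < k)%N -> 0 <= b k by move=> /gb; exact: le_trans.
have cb := bounded_ge0_cvgn b0 bM.
have sg : \sum_(1 <= k < N.+1) g k @[N --> \oo] --> infinite_sum g.
  by rewrite (cvg_shiftS (fun N => \sum_(1 <= k < N) g k)).
suff d0 : \sum_(1 <= k < N.+1) (f N k - g k) @[N --> \oo] --> (0 : R).
  rewrite -[infinite_sum g]add0r.
  have -> : (fun N => \sum_(1 <= k < N.+1) f N k) =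
     (fun N => \sum_(1 <= k < N.+1) (f N k - g k)) + (fun N => \sum_(1 <= k < N.+1) g k).
    apply/funext => N; rewrite -[RHS]/(_ + _) -big_split.
    by apply: eq_bigr => k _ /=; rewrite subrK.
  exact: cvgD.
apply/cvgrPdist_lt => e e0.
have e4 : 0 < e / 4 by rewrite divr_gt0.
(* The tail of [b] from [K] on stays below [e / 4]; counted twice, for [f N] and for [g], it leaves
   [e / 2] to the head. *)
have /cvgrPdist_lt/(_ _ e4) [K0 _ hK0] := infinite_sumP cb.
pose K := maxn 1 K0; have K1 : (1 <= K)%N by rewrite leq_maxl.
have hK : infinite_sum b - \sum_(1 <= k < K) b k < e / 4.
  by apply: le_lt_trans (ler_norm _) (hK0 K _); rewrite /= leq_maxr.
have hB N : \sum_(1 <= k < N) b k <= infinite_sum b.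
  apply: nondecreasing_cvgn_le cb N; apply/nondecreasing_seqP => -[|n].
    by rewrite !big_geq.
  by rewrite [leRHS]big_nat_recr //= lerDl b0.
have d1 : \sum_(1 <= k < K) `|f N k - g k| @[N --> \oo] --> (0 : R).
  have := @cvgn_sum_nat (fun N k => `|f N k - g k|) (fun=> 0) K.
  rewrite big1_eq; apply => k k0.
  rewrite -(@normr0 _ R) -(subrr (g k)).
  by apply: cvg_norm; apply: cvgB (fg k k0) _; exact: cvg_cst.
have e2 : 0 < e / 2 by rewrite divr_gt0.
have /cvgrPdist_lt/(_ _ e2) d1e := d1.
near=> N; rewrite sub0r normrN.
have KN : (K <= N)%N by near: N; exact: nbhs_infty_ge.
have d1N : \sum_(1 <= k < K) `|f N k - g k| < e / 2.
  have : `|0 - \sum_(1 <= k < K) `|f N k - g k| | < e / 2 by near: N.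
  by rewrite sub0r normrN; apply: le_lt_trans; exact: ler_norm.
apply: le_lt_trans (ler_norm_sum _ _ _) _.
rewrite (big_cat_nat K1 (leqW KN)) /= [ltRHS](_ : e = e / 2 + e / 2); last by field.
apply: ltr_leD => //.
apply: (@le_trans _ _ (\sum_(K <= k < N.+1) (b k + b k))).
  apply: ler_sum_nat => k /andP[Kk kN]; have k0 : (0 < k)%N by exact: leq_trans Kk.
  by apply: le_trans (ler_normB _ _) _; rewrite lerD ?gb ?fb // k0.
rewrite big_split /=.
have : \sum_(1 <= k < N.+1) b k = \sum_(1 <= k < K) b k + \sum_(K <= k < N.+1) b k.
  by rewrite (big_cat_nat K1 (leqW KN)).
have := hB N.+1; lra.
Unshelve. all: by end_near. Qed.

(** * Harmonic numbers and the summable majorant [H_k^2 / k^2] *)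

Lemma harmonic_numberS n :
  harmonic_number n.+1 = harmonic_number n + n.+1%:R^-1 :> R.
Proof. by rewrite /harmonic_number big_nat_recr //= mul1r. Qed.

Lemma harmonic_number_ge0 n : 0 <= harmonic_number n :> R.
Proof. by apply: sumr_ge0 => i _; rewrite divr_ge0. Qed.

Lemma harmonic_number_ge1 n : (0 < n)%N -> 1 <= harmonic_number n :> R.
Proof.
case: n => // n _; elim: n => [|n IH]; last first.
  by rewrite harmonic_numberS (le_trans IH)// lerDl invr_ge0.
by rewrite harmonic_numberS /harmonic_number big_geq // add0r invr1.
Qed.

(* [(H^2 + 3 H + 4) / N] decreases at least as fast as the partial sums grow. *)
Lemma harmonic_sqr_sum_le N :
  \sum_(1 <= k < N.+1) (harmonic_number k ^+ 2 / k%:R ^+ 2) <= 9 :> R.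
Proof.
case: N => [|N]; first by rewrite big_geq.
suff : \sum_(1 <= k < N.+2) (harmonic_number k ^+ 2 / k%:R ^+ 2) +
   (harmonic_number N.+1 ^+ 2 + 3 * harmonic_number N.+1 + 4) / N.+1%:R <= 9 :> R.
  apply: le_trans; rewrite lerDl divr_ge0 // !addr_ge0 //.
    exact: sqr_ge0.
  by rewrite mulr_ge0 ?harmonic_number_ge0.
(* For a single term the left side is [1 + (1 + 3 + 4) = 9], the source of the constant. *)
elim: N => [|N]; first by rewrite big_nat1 /harmonic_number big_nat1; lra.
apply: le_trans.
rewrite big_nat_recr //= -addrA lerD2l [harmonic_number N.+2]harmonic_numberS.
have h0 := harmonic_number_ge0 N.+1.
set h := harmonic_number N.+1 in h0 *.
have n0 : 0 < N.+1%:R :> R by rewrite ltr0n.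
have -> : N.+2%:R = N.+1%:R + 1 :> R by rewrite natr1.
set n := N.+1%:R in n0 *.
have n1 : 1 <= n by rewrite /n ler1n.
have np : 0 < n + 1 by lra.
have d0 : 0 < (n + 1)^-1 by rewrite invr_gt0.
set d := (n + 1)^-1 in d0 *.
have nd : n = d^-1 - 1 by rewrite /d invrK addrK.
have d2 : d <= 2^-1 by rewrite /d lef_pV2 ?posrE //; lra.
(* Here [1 / n = d / (1 - d)]; bounding it below by [d + d^2] makes the inequality polynomial in [h]
   and [d], and [d <= 1/2] settles its sign. *)
have ninv : d + d ^+ 2 <= n^-1.
  rewrite -[leRHS]mul1r ler_pdivlMr // nd.
  have -> : (d + d ^+ 2) * (d^-1 - 1) = 1 - d ^+ 2 by field; rewrite gt_eqF.
  by rewrite gerBl sqr_ge0.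
rewrite -exprVn -/d.
apply: (@le_trans _ _ ((h ^+ 2 + 3 * h + 4) * (d + d ^+ 2))); last first.
  apply: ler_wpM2l => //; nra.
rewrite -subr_ge0.
have -> : (h ^+ 2 + 3 * h + 4) * (d + d ^+ 2) -
  ((h + d) ^+ 2 * d ^+ 2 + ((h + d) ^+ 2 + 3 * (h + d) + 4) * d) =
  d ^+ 2 * (h * (1 - 2 * d) + (1 - d - d ^+ 2)) by ring.
rewrite mulr_ge0 ?sqr_ge0 // addr_ge0 ?mulr_ge0 //; first lra.
nra.
Qed.

End Tannery.


(** * Limits dominated by a power of [H_k] *)

Section DominatedLimit.
Variable R : realType.
Implicit Types (f : nat -> nat -> R) (g : nat -> R).

(* The shape of hypothesis under which Tannery's theorem is applied to
   [\sum_(k <= N) f N k / k ^ 2]. *)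
Definition dominated_limit (a : nat) f g :=
  (forall k, (0 < k)%N -> f^~ k @ \oo --> g k) /\
  exists C : R, forall N k, (0 < k <= N)%N ->
    `|f N k| <= C * harmonic_number k ^+ a.

(** Identities for truncated sums hold only for [k <= N]; at a fixed [k] this covers all large [N],
    which is enough for the limit. *)
Lemma dominated_limit_eq a f f' g g' :
  (forall N k, (0 < k <= N)%N -> f N k = f' N k) ->
  (forall k, (0 < k)%N -> g k = g' k) ->
  dominated_limit a f g -> dominated_limit a f' g'.
Proof.
move=> ff' gg' [lim_f [C hC]]; split => [k k0|].
  rewrite -gg' //; apply: cvg_trans (lim_f k k0); apply: near_eq_cvg.
  by near=> N; rewrite ff' // k0; near: N; exact: nbhs_infty_ge.
by exists C => N k kN; rewrite -ff' // hC.
Unshelve. all: by end_near. Qed.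

(** Rests on [H_k >= 1]; it brings terms of different growth to a common exponent. *)
Lemma dominated_limitW a b f g : (a <= b)%N ->
  dominated_limit a f g -> dominated_limit b f g.
Proof.
move=> ab [lim_f [C hC]]; split=> //; exists `|C| => N k kN.
have h1 : 1 <= harmonic_number k :> R.
  by apply: harmonic_number_ge1; case/andP: kN.
apply: le_trans (hC _ _ kN) _.
apply: (@le_trans _ _ (`|C| * harmonic_number k ^+ a)).
  by rewrite ler_wpM2r ?ler_norm // exprn_ge0 // (le_trans ler01).
by rewrite ler_wpM2l // ler_weXn2l.
Qed.

Lemma dominated_limitD a f g f' g' :
  dominated_limit a f g -> dominated_limit a f' g' ->
  dominated_limit a (fun N k => f N k + f' N k) (fun k => g k + g' k).
Proof.
move=> [lim_f [C hC]] [lim_f' [C' hC']]; split=> [k k0|].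
  exact: cvgD (lim_f k k0) (lim_f' k k0).
exists (C + C') => N k kN; apply: le_trans (ler_normD _ _) _.
by rewrite mulrDl lerD ?hC ?hC'.
Qed.

(** Exponents add, so a product of two factors of growth [H_k] reaches exactly the exponent 2
    allowed in [dominated_limit_sum]. *)
Lemma dominated_limitM a b f g f' g' :
  dominated_limit a f g -> dominated_limit b f' g' ->
  dominated_limit (a + b) (fun N k => f N k * f' N k) (fun k => g k * g' k).
Proof.
move=> [lim_f [C hC]] [lim_f' [C' hC']]; split=> [k k0|].
  exact: cvgM (lim_f k k0) (lim_f' k k0).
exists (C * C') => N k kN; rewrite normrM exprD mulrACA.
by apply: ler_pM; rewrite ?normr_ge0 ?hC ?hC'.
Qed.

Lemma dominated_limit_cst g (C : R) : (forall k, (0 < k)%N -> `|g k| <= C) ->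
  dominated_limit 0 (fun _ k => g k) g.
Proof.
move=> gC; split=> [k _|]; first exact: cvg_cst.
by exists C => N k /andP[k0 _]; rewrite mulr1 gC.
Qed.

Lemma dominated_limit_scale a (e : nat -> R) (C : R) f g :
  (forall k, (0 < k)%N -> `|e k| <= C) -> dominated_limit a f g ->
  dominated_limit a (fun N k => e k * f N k) (fun k => e k * g k).
Proof. by move=> eC; apply: (dominated_limitM (a := 0)); exact: dominated_limit_cst eC. Qed.

Lemma dominated_limit_sum f g : dominated_limit 2 f g ->
  cvgn (fun N => \sum_(1 <= k < N) (g k / k%:R ^+ 2)) /\
  \sum_(1 <= k < N.+1) (f N k / k%:R ^+ 2) @[N --> \oo] -->
    infinite_sum (fun k => g k / k%:R ^+ 2).
Proof.
move=> [lim_f [C hC]].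
apply: (@tannery R (fun N k => f N k / k%:R ^+ 2) _
  (fun k => `|C| * (harmonic_number k ^+ 2 / k%:R ^+ 2)) (`|C| * 9)) => [k k0|N k kN|N].
- by apply: cvgMr_tmp; exact: lim_f.
- rewrite normrM mulrA [X in _ * X]ger0_norm ?invr_ge0 ?exprn_ge0 //.
  rewrite ler_wpM2r ?invr_ge0 ?exprn_ge0 //.
  apply: le_trans (hC _ _ kN) _.
  by rewrite ler_wpM2r ?ler_norm // sqr_ge0.
- by rewrite -mulr_sumr ler_wpM2l // harmonic_sqr_sum_le.
Qed.

End DominatedLimit.

(** * Signed power sums *)

Section PowerSums.
Variable R : realType.
Implicit Types (t : R) (p n N k : nat).

(** For [t = 1] this is [zeta_n(p)], for [t = -1] it is [- L_n(p)]. The exponent [j] instead of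
    [j - 1] lets both signs obey the same reindexing rules. *)
Definition psum t p n : R := \sum_(1 <= j < n.+1) t ^+ j * j%:R^-1 ^+ p.

Lemma psum0 t p : psum t p 0 = 0.
Proof. by rewrite /psum big_geq. Qed.

Lemma psumS t p n : psum t p n.+1 = psum t p n + t ^+ n.+1 * n.+1%:R^-1 ^+ p.
Proof. by rewrite /psum big_nat_recr. Qed.

Lemma psum1E n : psum 1 1 n = harmonic_number n.
Proof. by apply: eq_bigr => j _; rewrite expr1n expr1. Qed.

Lemma sign_cases t : t ^+ 2 = 1 -> t = 1 \/ t = -1.
Proof. by move=> /eqP; rewrite sqrf_eq1 => /orP[]/eqP; [left|right]. Qed.

Lemma sign_exprD t k n : t ^+ 2 = 1 -> t ^+ k * t ^+ (n + k) = t ^+ n.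
Proof.
by move=> ht; rewrite exprD mulrCA -exprD addnn -mul2n exprM ht expr1n mulr1.
Qed.

Lemma sign_exprK t k : t ^+ 2 = 1 -> t ^+ k * t ^+ k = 1.
Proof. by move=> /(@sign_exprD t k 0). Qed.

Lemma sign_double n : (- 1) ^+ n.*2 = 1 :> R.
Proof. by rewrite -signr_odd odd_double. Qed.

Lemma sign_doubleS n : (- 1) ^+ n.*2.+1 = - 1 :> R.
Proof. by rewrite exprS sign_double mulr1. Qed.

Lemma natr_doubleS n : n.*2.+2%:R = 2 * n.+1%:R :> R.
Proof. by rewrite -doubleS -mul2n natrM. Qed.

Lemma norm_sign t k : t ^+ 2 = 1 -> `|t ^+ k| = 1.
Proof. by case/sign_cases => ->; rewrite normrX ?normrN normr1 expr1n. Qed.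

Lemma signM (s t : R) : s ^+ 2 = 1 -> t ^+ 2 = 1 -> (s * t) ^+ 2 = 1.
Proof. by rewrite exprMn => -> ->; rewrite mulr1. Qed.

Lemma natV_le1 n : n%:R^-1 <= 1 :> R.
Proof. by case: n => [|n]; rewrite ?invr0 // invf_le1 ?ltr0n // ler1n. Qed.

Lemma natVX_le p n : (0 < p)%N -> n%:R^-1 ^+ p <= n%:R^-1 :> R.
Proof. by case: p => // p _; rewrite exprS ler_piMr ?invr_ge0 // exprn_ile1 ?invr_ge0 ?natV_le1. Qed.

Lemma natVX_norm p n : `|n%:R^-1 ^+ p| = n%:R^-1 ^+ p :> R.
Proof. by rewrite ger0_norm // exprn_ge0 // invr_ge0. Qed.

(** The [i]-th extra term is at most [1 / (N + i) <= 1 / i], whence a bound independent of [N]. *)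
Lemma psum_tail_le t p N k : t ^+ 2 = 1 -> (0 < p)%N ->
  `|psum t p (N + k) - psum t p N| <= harmonic_number k.
Proof.
move=> ht p0; elim: k => [|k IH].
  by rewrite addn0 subrr normr0 harmonic_number_ge0.
rewrite addnS psumS addrAC harmonic_numberS.
apply: le_trans (ler_normD _ _) _; apply: lerD IH _.
rewrite normrM norm_sign // mul1r natVX_norm (le_trans (natVX_le _ p0)) //.
by rewrite lef_pV2 ?posrE ?ltr0n // ler_nat ltnS leq_addl.
Qed.

Lemma psum_le t p n : t ^+ 2 = 1 -> (0 < p)%N ->
  `|psum t p n| <= harmonic_number n.
Proof. by move=> ht p0; have := psum_tail_le 0 n ht p0; rewrite psum0 subr0. Qed.

Lemma psum_tail_cvg t p k : t ^+ 2 = 1 -> (0 < p)%N ->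
  psum t p (N + k) - psum t p N @[N --> \oo] --> (0 : R).
Proof.
move=> ht p0; elim: k => [|k IH].
  by under eq_fun do rewrite addn0 subrr; exact: cvg_cst.
under eq_fun do rewrite addnS psumS addrAC.
rewrite -[0]addr0; apply: cvgD IH _.
apply: norm_cvg0.
apply: (squeeze_cvgr (f := fun=> 0) _ _ (@cvg_harmonic R)); last exact: cvg_cst.
  near=> N; rewrite normr_ge0 /= normrM norm_sign // mul1r natVX_norm.
  apply: le_trans (natVX_le _ p0) _.
  by rewrite /harmonic lef_pV2 ?posrE ?ltr0n // ler_nat ltnS leq_addr.
Unshelve. all: by end_near. Qed.

Lemma psum_tail_dominated t p : t ^+ 2 = 1 -> (0 < p)%N ->
  dominated_limit 1 (fun N k => psum t p (N + k) - psum t p N) (fun=> 0).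
Proof.
move=> ht p0; split=> [k _|]; first exact: psum_tail_cvg.
by exists 1 => N k _; rewrite mul1r expr1 psum_tail_le.
Qed.

(** For [k <= N] this is the tail of length [k] after [N - k], so the results on tails apply. *)
Lemma psum_head_dominated t p : t ^+ 2 = 1 -> (0 < p)%N ->
  dominated_limit 1 (fun N k => psum t p N - psum t p (N - k)) (fun=> 0).
Proof.
move=> ht p0; split=> [k k0|].
  have h : psum t p (N - k + k) - psum t p (N - k) @[N --> \oo] --> (0 : R).
    rewrite (cvg_centern k (fun N => psum t p (N + k) - psum t p N)).
    exact: psum_tail_cvg.
  apply: cvg_trans h; apply: near_eq_cvg.
  by near=> N; rewrite subnK //; near: N; exact: nbhs_infty_ge.
exists 1 => N k /andP[_ kN]; rewrite mul1r expr1.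
by rewrite -{1}(subnK kN) psum_tail_le.
Unshelve. all: by end_near. Qed.

(** Since [t ^ l = t ^ k * t ^ (l + k)], the sum is a block of [psum] from [k + 1] to [N + k]. *)
Lemma psum_shift t p N k : t ^+ 2 = 1 ->
  \sum_(1 <= l < N.+1) t ^+ l * (l%:R + k%:R)^-1 ^+ p =
  t ^+ k * (psum t p (N + k) - psum t p k).
Proof.
move=> ht; elim: N => [|N IH]; first by rewrite big_geq // subrr mulr0.
rewrite big_nat_recr //= IH addSn psumS -natrD addSn -(sign_exprD k N.+1 ht) addSn.
by ring.
Qed.

(** The terms [l > k] give [psum] up to [N - k]; the terms [l < k], read backwards, give [psum] up
    to [k - 1] with sign [(-1) ^ p]; the term [l = k] is zero because [0^-1 = 0] and [p > 0]. *)
Lemma psum_reflect t p N k : t ^+ 2 = 1 -> (0 < p)%N -> (0 < k <= N)%N ->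
  \sum_(1 <= l < N.+1) t ^+ l * (l%:R - k%:R)^-1 ^+ p =
  t ^+ k * (psum t p (N - k) + (- 1) ^+ p * psum t p k.-1).
Proof.
move=> ht p0 /andP[k0 kN].
rewrite -(subnK kN) addnK; elim: (N - k)%N => [|n IH].
  rewrite add0n big_nat_recr //= subrr invr0 expr0n (gtn_eqF p0) mulr0 addr0 psum0 add0r.
  rewrite big_nat_rev /= mulrA mulr_sumr prednK // big_seq [RHS]big_seq.
  apply: eq_bigr => l; rewrite mem_index_iota => /andP[l0 lk].
  rewrite add1n subSS natrB 1?ltnW // -(sign_exprD l (k - l) ht) subnK 1?ltnW //.
  by rewrite addrAC subrr sub0r invrN [(- l%:R^-1) ^+ p]exprNn; ring.
rewrite addSn big_nat_recr //= IH psumS -addSn natrD addrK exprD.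
by ring.
Qed.

Lemma sign_term_le t p k : t ^+ 2 = 1 -> (1 < p)%N -> (0 < k)%N ->
  `|t ^+ k * k%:R^-1 ^+ p| <= harmonic_number k ^+ 2 / k%:R ^+ 2.
Proof.
move=> ht p1 k0; rewrite normrM norm_sign // mul1r natVX_norm -exprVn.
apply: (@le_trans _ _ (k%:R^-1 ^+ 2)).
  by rewrite ler_wiXn2l ?invr_ge0 ?natV_le1.
rewrite ler_peMl ?exprn_ge0 ?invr_ge0 // expr_ge1 ?harmonic_number_ge0 //.
exact: harmonic_number_ge1.
Qed.

Lemma sign_series_cvgn t p : t ^+ 2 = 1 -> (1 < p)%N ->
  cvgn (fun N => \sum_(1 <= k < N) t ^+ k * k%:R^-1 ^+ p).
Proof.
move=> ht p1; apply: (dominated_cvgn _ (@harmonic_sqr_sum_le R)) => k k0.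
exact: sign_term_le.
Qed.

Lemma psum_cvg t p : t ^+ 2 = 1 -> (1 < p)%N ->
  psum t p @ \oo --> infinite_sum (fun n => t ^+ n * n%:R^-1 ^+ p).
Proof.
move=> ht p1; rewrite (cvg_shiftS (fun N => \sum_(1 <= k < N) _)).
exact: sign_series_cvgn.
Qed.

(** * Logarithmic bounds and the alternating harmonic series *)

Lemma lnS_bounds (m : nat) : (0 < m)%N ->
  m.+1%:R^-1 <= ln (m.+1%:R : R) - ln m%:R <= m%:R^-1.
Proof.
move=> m0; have m0' : 0 < m%:R :> R by rewrite ltr0n.
rewrite -ln_div ?posrE ?ltr0n //; apply/andP; split.
  rewrite -lerN2 -lnV ?posrE ?divr_gt0 ?ltr0n // invf_div.
  have -> : m%:R / m.+1%:R = 1 + - m.+1%:R^-1 :> R.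
    by field; rewrite addrC natr1 pnatr_eq0.
  apply: le_ln1Dx; rewrite ltrN2 invf_lt1 ?ltr0n // ltr1n.
  by rewrite ltnS.
have -> : m.+1%:R / m%:R = 1 + m%:R^-1 :> R.
  by rewrite -natr1; field; rewrite gt_eqF.
by apply: le_ln1Dx; apply: (@lt_trans _ _ 0); rewrite ?ltrN10 ?invr_gt0.
Qed.

Lemma harmonic_tail_ln n k : (0 < n)%N ->
  ln (n + k).+1%:R - ln n.+1%:R <=
    (harmonic_number (n + k) : R) - harmonic_number n <=
    ln (n + k)%:R - ln n%:R.
Proof.
move=> n0; elim: k => [|k IH]; first by rewrite addn0 !subrr lexx.
rewrite addnS harmonic_numberS.
have nk : (0 < n + k)%N by rewrite addn_gt0 n0.
have /andP[k1 _] := lnS_bounds nk.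
have /andP[_ k2] := @lnS_bounds (n + k).+1 isT.
move: IH => /andP[? ?]; set v := (n + k).+1%:R^-1 in k1 k2 *.
by apply/andP; split; lra.
Qed.

(** Negate [H_2n] and add its even-indexed terms back twice; those terms sum to [H_n / 2]. *)
Lemma psum_alt_double n :
  psum (-1) 1 n.*2 = harmonic_number n - harmonic_number n.*2.
Proof.
elim: n => [|n IH]; first by rewrite psum0 subrr.
rewrite doubleS !psumS !harmonic_numberS IH !expr1.
rewrite natr_doubleS sign_doubleS -doubleS sign_double.
by field; rewrite !nat1r !pnatr_eq0.
Qed.

Lemma psum_alt_double_ln2 n :
  `|psum (-1) 1 n.*2 + ln 2| <= n.*2.+1%:R^-1.
Proof.
case: n => [|n].
  rewrite psum0 add0r invr1; have /andP[] := @lnS_bounds 1 isT.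
  by rewrite ln1 subr0 => ? ?; rewrite ler_norml; apply/andP; split; lra.
have /andP[] := @harmonic_tail_ln n.+1 n.+1 isT; rewrite addnn => lb ub.
have e1 m : (0 < m)%N -> ln m.*2%:R = ln 2 + ln m%:R :> R.
  by move=> m0; rewrite -mul2n natrM lnM ?posrE ?ltr0n.
(* With [m = n + 1], the gap between [ln 2] and the lower bound [ln(2 m + 1) - ln(m + 1)] is
   [ln(2 m + 2) - ln(2 m + 1)]. *)
have /andP[_] := @lnS_bounds n.+1.*2.+1 isT.
rewrite psum_alt_double -doubleS e1 //; rewrite e1 // in ub.
have : 0 <= n.+1.*2.+1%:R^-1 :> R by rewrite invr_ge0.
set v := n.+1.*2.+1%:R^-1 => v0 hv.
by rewrite ler_norml; apply/andP; split; lra.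
Qed.

(** Here [harmonic N] is [1 / (N + 1)], not a harmonic number. For odd [N = 2 n + 1] the last term
    costs a second [1 / (2 n + 1)], and [2 / (2 n + 1) <= 4 / (2 n + 2)]. *)
Lemma psum_alt_ln2 N : `|psum (-1) 1 N + ln 2| <= 4 * harmonic N.
Proof.
rewrite -(odd_double_half N); move: (N./2) => n; case: (odd N).
  rewrite add1n psumS addrAC.
  apply: le_trans (ler_normD _ _) _.
  apply: (@le_trans _ _ (n.*2.+1%:R^-1 + n.*2.+1%:R^-1)).
    apply: lerD; first exact: psum_alt_double_ln2.
    by rewrite normrM norm_sign ?sqrrN ?expr1n // mul1r natVX_norm expr1.
  rewrite /harmonic ler_pdivlMr ?ltr0n // -[n.*2.+2%:R]natr1.
  have : n.*2.+1%:R^-1 * n.*2.+1%:R = 1 :> R by rewrite mulVf // pnatr_eq0.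
  have := @natV_le1 n.*2.+1; move: (n.*2.+1%:R) => x v1 vx.
  by rewrite mulrDr mulr1 mulrDl vx; lra.
apply: le_trans (psum_alt_double_ln2 n) _.
by rewrite add0n /harmonic ler_peMl ?invr_ge0 // ler1n.
Qed.

Lemma psum_alt_cvg : psum (-1) 1 @ \oo --> - ln 2.
Proof.
apply/cvgrPdist_le => e e0.
have /cvgrPdist_le/(_ (e / 4)) h := @cvg_harmonic R.
have {}h := h ltac:(by rewrite divr_gt0).
near=> N; rewrite -normrN opprB opprK /=.
apply: le_trans (psum_alt_ln2 N) _.
have : `|0 - @harmonic R N| <= e / 4 by near: N.
by rewrite sub0r normrN ger0_norm ?harmonic_ge0 //; lra.
Unshelve. all: by end_near. Qed.

Lemma psum_alt_bounded N : `|psum (-1) 1 N| <= `|ln 2| + 4.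
Proof.
rewrite -[psum _ _ _](addrK (ln 2)) addrC -[X in _ <= X + _]normrN.
apply: le_trans (ler_normD _ _) _; rewrite lerD2l.
by apply: le_trans (psum_alt_ln2 N) _; rewrite ler_piMr // natV_le1.
Qed.

End PowerSums.


(** * Sequences with reducible Dirichlet series *)

Section LinearSequences.
Variable R : realType.
Implicit Types (a f g : nat -> R) (s t : R) (p q n : nat).

Lemma sign1 : 1 ^+ 2 = 1 :> R.
Proof. exact: expr1n. Qed.

Lemma signN1 : (- 1) ^+ 2 = 1 :> R.
Proof. by rewrite sqrrN expr1n. Qed.

Lemma reducible_series_eq a b : (forall n, (0 < n)%N -> a n = b n) ->
  reducible_series a -> reducible_series b.
Proof.
move=> ab; suff e : (fun N => \sum_(1 <= n < N) a n) =
    (fun N => \sum_(1 <= n < N) b n) by rewrite /reducible_series /infinite_sum e.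
by apply/funext => N; apply: eq_big_nat => n /andP[n0 _]; exact: ab.
Qed.

Lemma reducible_seriesD a b : reducible_series a -> reducible_series b ->
  reducible_series (fun n => a n + b n).
Proof.
move=> [ca ra] [cb rb].
have cab : \sum_(1 <= n < N) (a n + b n) @[N --> \oo] -->
    infinite_sum a + infinite_sum b.
  by under eq_fun do rewrite big_split /=; exact: cvgD.
split; first by apply/cvg_ex; exists (infinite_sum a + infinite_sum b).
by rewrite (infinite_sum_eq cab); exact: reducibleD.
Qed.

Lemma reducible_seriesZ (c : R) a : reducible_to_linear c ->
  reducible_series a -> reducible_series (fun n => c * a n).
Proof.
move=> rc [ca ra].
have cab : \sum_(1 <= n < N) (c * a n) @[N --> \oo] --> c * infinite_sum a.
  by under eq_fun do rewrite -mulr_sumr; exact: cvgMl_tmp.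
split; first by apply/cvg_ex; exists (c * infinite_sum a).
by rewrite (infinite_sum_eq cab); exact: reducibleM.
Qed.

(** Quantifying over all exponents and both signs makes the class stable under multiplication by
    signs and inverse powers. *)
Definition linear_seq f := forall q t, (1 < q)%N -> t ^+ 2 = 1 ->
  reducible_series (fun n => t ^+ n * f n * n%:R^-1 ^+ q).

(** Products of two linear sequences may lead to quadratic sums. The multipliers that preserve
    linearity, such as reducible constants, signs and inverse powers, are closed under sums and
    products. *)
Definition linear_coef f := forall g, linear_seq g ->
  linear_seq (fun n => f n * g n).

Lemma linear_seq_eq f g : (forall n, (0 < n)%N -> f n = g n) ->
  linear_seq f -> linear_seq g.
Proof.
move=> fg lf q t q1 ht; apply: reducible_series_eq (lf q t q1 ht) => n n0.
by rewrite fg.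
Qed.

Lemma linear_seqD f g : linear_seq f -> linear_seq g ->
  linear_seq (fun n => f n + g n).
Proof.
move=> lf lg q t q1 ht.
apply: reducible_series_eq (reducible_seriesD (lf q t q1 ht) (lg q t q1 ht)) => n _.
by rewrite mulrDr mulrDl.
Qed.

Lemma linear_seqZ (c : R) f : reducible_to_linear c -> linear_seq f ->
  linear_seq (fun n => c * f n).
Proof.
move=> rc lf q t q1 ht.
apply: reducible_series_eq (reducible_seriesZ rc (lf q t q1 ht)) => n _.
by rewrite !mulrA [c * _]mulrC.
Qed.

Lemma linear_seq_sign s f : s ^+ 2 = 1 -> linear_seq f ->
  linear_seq (fun n => s ^+ n * f n).
Proof.
move=> hs lf q t q1 ht.
apply: reducible_series_eq (lf q (t * s) q1 (signM ht hs)) => n _.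
by rewrite exprMn mulrA.
Qed.

Lemma linear_seqV j f : linear_seq f ->
  linear_seq (fun n => n%:R^-1 ^+ j * f n).
Proof.
move=> lf q t q1 ht.
apply: reducible_series_eq (lf (j + q)%N t (leq_trans q1 (leq_addl _ _)) ht) => n _.
by rewrite exprD; ring.
Qed.

Lemma linear_coef_eq f g : (forall n, (0 < n)%N -> f n = g n) ->
  linear_coef f -> linear_coef g.
Proof.
by move=> fg lf h lh; apply: linear_seq_eq (lf h lh) => n n0; rewrite fg.
Qed.

Lemma linear_coefD f g : linear_coef f -> linear_coef g ->
  linear_coef (fun n => f n + g n).
Proof.
move=> lf lg h lh; apply: linear_seq_eq (linear_seqD (lf h lh) (lg h lh)) => n _.
by rewrite mulrDl.
Qed.

Lemma linear_coefM f g : linear_coef f -> linear_coef g ->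
  linear_coef (fun n => f n * g n).
Proof.
by move=> lf lg h lh; apply: linear_seq_eq (lf _ (lg h lh)) => n _; rewrite mulrA.
Qed.

Lemma linear_coef_cst (c : R) : reducible_to_linear c -> linear_coef (fun=> c).
Proof. by move=> rc h lh; exact: linear_seqZ. Qed.

Lemma linear_coef_sign s : s ^+ 2 = 1 -> linear_coef (fun n => s ^+ n).
Proof. by move=> hs h lh; exact: linear_seq_sign. Qed.

Lemma linear_coefV j : linear_coef (fun n => n%:R^-1 ^+ j).
Proof. by move=> h lh; exact: linear_seqV. Qed.

Lemma linear_coefB f g : linear_coef f -> linear_coef g ->
  linear_coef (fun n => f n - g n).
Proof.
move=> lf lg; apply: (@linear_coef_eq (fun n => f n + (-1) * g n)) => [n _|].
  by rewrite mulN1r.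
apply: linear_coefD lf (linear_coefM _ lg).
exact: linear_coef_cst (reducible_int R (-1)).
Qed.

Lemma zetaE k : zeta k = infinite_sum (fun n => 1 ^+ n * n%:R^-1 ^+ k) :> R.
Proof.
by congr infinite_sum; apply/funext => n; rewrite expr1n exprVn.
Qed.

Lemma cvg_double : n.*2 @[n --> \oo] --> \oo.
Proof.
apply/cvgnyPge => A; near=> n.
by apply: (@leq_trans n); [near: n; exact: nbhs_infty_ge|rewrite -addnn leq_addr].
Unshelve. all: by end_near. Qed.

(* The even-indexed terms of [zeta q] sum to [2^-q zeta q]. *)
Lemma alt_zetaE q : (1 < q)%N ->
  infinite_sum (fun n => (- 1) ^+ n * n%:R^-1 ^+ q) =
  2 * 2^-1 ^+ q * zeta q - zeta q :> R.
Proof.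
move=> q1.
have c1 : psum (1 : R) q @ \oo --> zeta q.
  by rewrite zetaE; exact: psum_cvg sign1 q1.
have c2 := psum_cvg signN1 q1.
have e N : psum (- 1) q N.*2 + psum 1 q N.*2 = 2 * 2^-1 ^+ q * psum (1 : R) q N.
  elim: N => [|N IH]; first by rewrite !psum0 mulr0 addr0.
  rewrite doubleS !psumS mulrDr -IH !expr1n.
  rewrite natr_doubleS sign_doubleS -doubleS sign_double.
  by rewrite invfM exprMn; ring.
have c3 : psum (- 1 : R) q N.*2 + psum 1 q N.*2 @[N --> \oo] -->
    2 * 2^-1 ^+ q * zeta q.
  have h : 2 * 2^-1 ^+ q * psum (1 : R) q N @[N --> \oo] --> 2 * 2^-1 ^+ q * zeta q.
    exact: (cvgMl_tmp c1).
  by apply: cvg_trans h; apply: near_eq_cvg; near=> N; rewrite [RHS]e.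
have c4 : psum (- 1 : R) q N.*2 + psum 1 q N.*2 @[N --> \oo] -->
    infinite_sum (fun n => (- 1) ^+ n * n%:R^-1 ^+ q) + zeta q.
  exact: (cvg_comp _ _ cvg_double (cvgD c2 c1)).
by rewrite -(cvg_unique (@norm_hausdorff _ _) c4 c3) addrK.
Unshelve. all: by end_near. Qed.

Lemma linear_seq1 : linear_seq (fun=> 1).
Proof.
move=> q t q1 ht.
apply: (@reducible_series_eq (fun n => t ^+ n * n%:R^-1 ^+ q)) => [n _|].
  by rewrite mulr1.
split; first exact: sign_series_cvgn.
have rz : reducible_to_linear (zeta q : R).
  by apply: reducible_linear; exact: LCzeta.
case/sign_cases: ht => ->; first by rewrite -zetaE.
rewrite alt_zetaE //; apply: reducibleD; last exact: reducibleN.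
apply: reducibleM => //.
have -> : 2 * 2^-1 ^+ q = ratr (2 * 2^-1 ^+ q) :> R.
  by rewrite rmorphM /= rmorphXn /= fmorphV /= !ratr_nat.
exact: reducible_ratr.
Qed.

Lemma psum1_zeta p n : psum (1 : R) p n = zeta_partial n p.
Proof. by apply: eq_bigr => j _; rewrite expr1n exprVn. Qed.

Lemma psumN1_alt p n : psum (- 1 : R) p n = - alt_partial n p.
Proof.
rewrite /psum /alt_partial -sumrN; apply: eq_big_nat => -[//|j] _.
by rewrite exprS mulN1r mulNr exprVn.
Qed.

Lemma psum_series_cvgn p q s t :
  (0 < p)%N -> (1 < q)%N -> s ^+ 2 = 1 -> t ^+ 2 = 1 ->
  cvgn (fun N => \sum_(1 <= n < N) t ^+ n * psum s p n * n%:R^-1 ^+ q).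
Proof.
move=> p0 q1 hs ht; apply: (dominated_cvgn _ (@harmonic_sqr_sum_le R)) => k k0.
have h1 := @harmonic_number_ge1 R _ k0.
rewrite !normrM norm_sign // mul1r natVX_norm -exprVn.
apply: ler_pM; rewrite ?exprn_ge0 ?invr_ge0 //; last first.
  by rewrite ler_wiXn2l ?invr_ge0 ?natV_le1.
apply: le_trans (psum_le _ hs p0) _.
by rewrite expr2 ler_peMl // (le_trans ler01).
Qed.

(** The sign [c] reconciles [t ^ n] and [psum (-1)] with [(-1) ^ (n - 1)] and [L_n]. *)
Lemma reducible_series_linear (c : R) a b : c ^+ 2 = 1 ->
  (forall n, (0 < n)%N -> c * b n = a n) ->
  cvgn (fun N => \sum_(1 <= n < N) a n) ->
  linear_constant (infinite_sum b) -> reducible_series a.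
Proof.
move=> hc ab ca lb; split => //.
have cb : \sum_(1 <= n < N) b n @[N --> \oo] --> c * infinite_sum a.
  have h : c * (\sum_(1 <= n < N) a n) @[N --> \oo] --> c * infinite_sum a.
    exact: (cvgMl_tmp (infinite_sumP ca)).
  apply: cvg_trans h; apply: near_eq_cvg.
  near=> N; rewrite mulr_sumr; apply: eq_big_nat => n /andP[n0 _].
  by rewrite -ab // mulrA -expr2 hc mul1r.
rewrite -[infinite_sum a]mul1r -hc expr2 -mulrA -(infinite_sum_eq cb).
apply: reducibleM; last exact: reducible_linear.
by case/sign_cases: hc => ->; [exact: (reducible_int R 1)|exact: (reducible_int R (-1))].
Unshelve. all: by end_near. Qed.

(** The four choices of the two signs are, up to sign, the four families of linear Euler sums. *)
Lemma linear_seq_psum p s : (0 < p)%N -> s ^+ 2 = 1 -> linear_seq (psum s p).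
Proof.
move=> p0 hs q t q1 ht; have c := psum_series_cvgn p0 q1 hs ht.
have sgn n : (0 < n)%N -> (- 1) ^+ n = - (- 1) ^+ n.-1 :> R.
  by case: n => // n _; rewrite exprS mulN1r.
case/sign_cases: hs c => -> ; case/sign_cases: ht => -> c.
- apply: (reducible_series_linear sign1 _ c (@LCzeta_sum R _ _ p0 q1)) => n _.
  by rewrite psum1_zeta expr1n !mul1r exprVn.
- apply: (reducible_series_linear signN1 _ c (@LCzeta_altsum R _ _ p0 q1)) => n n0.
  by rewrite psum1_zeta (sgn n n0) exprVn; ring.
- apply: (reducible_series_linear signN1 _ c (@LCalt_sum R _ _ p0 q1)) => n _.
  by rewrite psumN1_alt expr1n exprVn; ring.
- apply: (reducible_series_linear sign1 _ c (@LCalt_altsum R _ _ p0 q1)) => n n0.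
  by rewrite psumN1_alt (sgn n n0) exprVn; ring.
Qed.

Lemma linear_coef_seq f : linear_coef f -> linear_seq f.
Proof.
by move=> lf; apply: linear_seq_eq (lf _ linear_seq1) => n _; rewrite mulr1.
Qed.

Lemma psum_limit p t : (1 < p)%N -> t ^+ 2 = 1 ->
  exists2 z : R, reducible_to_linear z & psum t p @ \oo --> z.
Proof.
move=> p1 ht.
exists (infinite_sum (fun n => t ^+ n * n%:R^-1 ^+ p)).
  have [_] := linear_seq1 p1 ht.
  by under [X in infinite_sum X]eq_fun do rewrite mulr1.
exact: psum_cvg.
Qed.

(** For [t = 1] the divergent [H_N] is multiplied by zero; for [t = -1] the limit is [- ln 2]. This
    is how [ln 2] enters the reduction. *)
Lemma alt_psum1_limit t : t ^+ 2 = 1 ->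
  exists2 c : R, reducible_to_linear c &
    dominated_limit 0 (fun N k => (1 - t ^+ k) * psum t 1 N)
                      (fun k => (1 - t ^+ k) * c).
Proof.
case/sign_cases => ->.
  exists 0; first exact: (reducible_int R 0).
  have h : dominated_limit 0 (fun _ _ => 0) (fun=> 0 : R).
    by apply: (@dominated_limit_cst _ _ 0) => k _; rewrite normr0.
  apply: dominated_limit_eq h => [N k _|k _]; last by rewrite mulr0.
  by rewrite expr1n subrr mul0r.
exists (- ln 2); first by apply/reducibleN/reducible_linear/LCln2.
split=> [k _|]; first exact: cvgMl_tmp (@psum_alt_cvg R).
exists (2 * (`|ln 2| + 4)) => N k _; rewrite mulr1 normrM.
apply: ler_pM => //; last exact: psum_alt_bounded.
apply: le_trans (ler_normB _ _) _.
by rewrite normr1 norm_sign ?signN1.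
Qed.
End LinearSequences.


(** * Partial fractions and two-sided sums *)

Section PartialFractions.
Variable F : fieldType.

(* With [0^-1 = 0] the identity also covers the coincidences between x, a, b. *)
Lemma inv_sub_mul (x a b : F) :
  (x - a)^-1 * (x - b)^-1 =
  (a - b)^-1 * (x - a)^-1 + (b - a)^-1 * (x - b)^-1
  + (a - b)^-1 ^+ 2 * (x == a)%:R + (b - a)^-1 ^+ 2 * (x == b)%:R
  + (a == b)%:R * (x - a)^-1 ^+ 2.
Proof.
have [->|ab] := eqVneq a b.
  by rewrite subrr invr0 expr0n /= !mul0r !add0r mul1r expr2.
rewrite mul0r addr0.
have ab0 : a - b != 0 by rewrite subr_eq0.
have ba0 : b - a != 0 by rewrite subr_eq0 eq_sym.
have [->|xa] := eqVneq x a.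
  rewrite (negbTE ab) subrr invr0 mul0r mulr0 mulr0 add0r addr0 mulr1.
  by rewrite -(opprB a b) invrN mulNr expr2 addNr.
have [->|xb] := eqVneq x b.
  rewrite subrr invr0 !mulr0 !addr0 mulr1.
  by rewrite -(opprB a b) invrN sqrrN expr2 mulrN addNr.
by rewrite !mulr0 !addr0; field; rewrite ab0 ba0 !subr_eq0 xa xb.
Qed.

(** [inv_sub_mul] is summed with [i] innermost. In its second and fourth terms [k] and [l] are
    exchanged, so that the factor depending on [i] always involves [y k] alone. *)
Lemma sum_inv_sub_mul (I K : Type) (r : seq I) (q : seq K)
    (x w : I -> F) (y u v : K -> F) :
  \sum_(i <- r) w i * ((\sum_(k <- q) u k * (x i - y k)^-1) *
                       (\sum_(l <- q) v l * (x i - y l)^-1)) =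
  \sum_(k <- q) u k * (\sum_(i <- r) w i * (x i - y k)^-1) *
                (\sum_(l <- q) v l * (y k - y l)^-1)
  + \sum_(k <- q) v k * (\sum_(i <- r) w i * (x i - y k)^-1) *
                (\sum_(l <- q) u l * (y k - y l)^-1)
  + \sum_(k <- q) u k * (\sum_(i <- r) w i * (x i == y k)%:R) *
                (\sum_(l <- q) v l * (y k - y l)^-1 ^+ 2)
  + \sum_(k <- q) v k * (\sum_(i <- r) w i * (x i == y k)%:R) *
                (\sum_(l <- q) u l * (y k - y l)^-1 ^+ 2)
  + \sum_(k <- q) \sum_(l <- q) u k * v l * (y k == y l)%:R *
                (\sum_(i <- r) w i * (x i - y k)^-1 ^+ 2).
Proof.
pose T1 k l := u k * v l * (y k - y l)^-1 * \sum_(i <- r) w i * (x i - y k)^-1.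
pose T2 k l := u k * v l * (y l - y k)^-1 * \sum_(i <- r) w i * (x i - y l)^-1.
pose T3 k l := u k * v l * (y k - y l)^-1 ^+ 2 * \sum_(i <- r) w i * (x i == y k)%:R.
pose T4 k l := u k * v l * (y l - y k)^-1 ^+ 2 * \sum_(i <- r) w i * (x i == y l)%:R.
pose T5 k l := u k * v l * (y k == y l)%:R * \sum_(i <- r) w i * (x i - y k)^-1 ^+ 2.
transitivity (\sum_(k <- q) \sum_(l <- q) (T1 k l + T2 k l + T3 k l + T4 k l + T5 k l)).
  under eq_bigr => i _ do rewrite big_distrlr /= mulr_sumr.
  rewrite exchange_big /=; apply: eq_bigr => k _.
  under eq_bigr => i _ do rewrite mulr_sumr.
  rewrite exchange_big /=; apply: eq_bigr => l _.
  rewrite /T1 /T2 /T3 /T4 /T5 !mulr_sumr -!big_split /=; apply: eq_bigr => i _.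
  by rewrite mulrACA inv_sub_mul; ring.
under eq_bigr => k _ do rewrite !big_split /=.
rewrite !big_split /=; congr (_ + _ + _ + _ + _).
- by apply: eq_bigr => k _; rewrite mulr_sumr; apply: eq_bigr => l _; rewrite /T1; ring.
- rewrite exchange_big /=; apply: eq_bigr => k _; rewrite mulr_sumr.
  by apply: eq_bigr => l _; rewrite /T2; ring.
- by apply: eq_bigr => k _; rewrite mulr_sumr; apply: eq_bigr => l _; rewrite /T3; ring.
- rewrite exchange_big /=; apply: eq_bigr => k _; rewrite mulr_sumr.
  by apply: eq_bigr => l _; rewrite /T4; ring.
Qed.

End PartialFractions.

(** * Two-sided sums truncated at [N], and their recurrences *)

Section TwoSidedSums.
Variable R : realType.
Implicit Types (r s t : R) (e b N k n : nat).

(** The sum over [0 < |n| <= N] of [r^|n| n^-e (n - k)^-b]; for [b > 0] the pole [n = k] drops out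
    because [0^-1 = 0]. *)
Definition signed_sum r e b N k : R :=
  \sum_(1 <= n < N.+1) r ^+ n *
    (n%:R^-1 ^+ e * (n%:R - k%:R)^-1 ^+ b +
     (- n%:R)^-1 ^+ e * (- n%:R - k%:R)^-1 ^+ b).

(** [Q_t(x)] truncated at [N]. *)
Definition pole_sum t N (x : R) : R :=
  \sum_(1 <= l < N.+1) t ^+ l * l%:R^-1 * (x - l%:R)^-1.

(** The truncation of [- Q_t'(x)], produced by the coincidence terms of the partial fractions. *)
Definition double_pole_sum t N (x : R) : R :=
  \sum_(1 <= l < N.+1) t ^+ l * l%:R^-1 * (x - l%:R)^-1 ^+ 2.

Lemma sum_nat_eq N k (f : nat -> R) : (0 < k <= N)%N ->
  \sum_(1 <= n < N.+1) f n * (n%:R == k%:R :> R)%:R = f k.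
Proof.
move=> /andP[k0 kN].
have kin : k \in index_iota 1 N.+1 by rewrite mem_index_iota k0.
rewrite (big_rem k) //= eqxx mulr1 big_seq big1 ?addr0 // => n.
rewrite mem_rem_uniq ?iota_uniq // inE => /andP[nk _].
by rewrite eqr_nat (negbTE nk) mulr0.
Qed.

(** [sum_inv_sub_mul] is applied at the points [n] and at the points [- n], and the results are
    added; only the positive points can meet a pole [k]. *)
Lemma pole_sum_mul r s t e N :
  \sum_(1 <= n < N.+1) r ^+ n *
    (n%:R^-1 ^+ e * (pole_sum s N n%:R * pole_sum t N n%:R) +
     (- n%:R)^-1 ^+ e * (pole_sum s N (- n%:R) * pole_sum t N (- n%:R))) =
  \sum_(1 <= k < N.+1)
    (s ^+ k * k%:R^-1 * signed_sum r e 1 N k * pole_sum t N k%:R +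
     t ^+ k * k%:R^-1 * signed_sum r e 1 N k * pole_sum s N k%:R +
     s ^+ k * k%:R^-1 * (r ^+ k * k%:R^-1 ^+ e) * double_pole_sum t N k%:R +
     t ^+ k * k%:R^-1 * (r ^+ k * k%:R^-1 ^+ e) * double_pole_sum s N k%:R +
     s ^+ k * k%:R^-1 * (t ^+ k * k%:R^-1) * signed_sum r e 2 N k).
Proof.
under eq_bigr => n _ do rewrite mulrDr !mulrA -[X in X + _]mulrA -[X in _ + X]mulrA.
rewrite big_split /= /pole_sum.
rewrite (sum_inv_sub_mul _ _ (fun n => n%:R) (fun n => r ^+ n * n%:R^-1 ^+ e)
  (fun n => n%:R) (fun l => s ^+ l * l%:R^-1) (fun l => t ^+ l * l%:R^-1)).
rewrite (sum_inv_sub_mul _ _ (fun n => - n%:R) (fun n => r ^+ n * (- n%:R)^-1 ^+ e)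
  (fun n => n%:R) (fun l => s ^+ l * l%:R^-1) (fun l => t ^+ l * l%:R^-1)).
rewrite -!big_split /=; apply: eq_big_nat => k kN.
have k0 : (0 < k)%N by case/andP: kN.
rewrite !(sum_nat_eq (fun n => r ^+ n * n%:R^-1 ^+ e)) //.
have -> : \sum_(1 <= i < N.+1)
    r ^+ i * (- i%:R)^-1 ^+ e * (- i%:R == k%:R :> R)%:R = 0.
  apply: big1_seq => i _; rewrite eq_sym -subr_eq0 opprK -natrD pnatr_eq0.
  by rewrite addn_eq0 (gtn_eqF k0) mulr0.
(* The last double sum of the expansion collapses to [l = k]. *)
have diag (X : R) : \sum_(1 <= l < N.+1) s ^+ k / k%:R * (t ^+ l / l%:R) *
    (k%:R == l%:R :> R)%:R * X = s ^+ k / k%:R * (t ^+ k / k%:R) * X.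
  rewrite -mulr_suml; congr (_ * _).
  under eq_bigr => l _ do rewrite eq_sym.
  by rewrite (sum_nat_eq (fun l => s ^+ k / k%:R * (t ^+ l / l%:R))).
rewrite !diag.
have sg1 : signed_sum r e 1 N k =
    \sum_(1 <= i < N.+1) r ^+ i * i%:R^-1 ^+ e * (i%:R - k%:R)^-1 +
    \sum_(1 <= i < N.+1) r ^+ i * (- i%:R)^-1 ^+ e * (- i%:R - k%:R)^-1.
  by rewrite -big_split /=; apply: eq_bigr => i _; rewrite !expr1; ring.
have sg2 : signed_sum r e 2 N k =
    \sum_(1 <= i < N.+1) r ^+ i * i%:R^-1 ^+ e * (i%:R - k%:R)^-1 ^+ 2 +
    \sum_(1 <= i < N.+1) r ^+ i * (- i%:R)^-1 ^+ e * (- i%:R - k%:R)^-1 ^+ 2.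
  by rewrite -big_split /=; apply: eq_bigr => i _; rewrite mulrDr !mulrA.
by rewrite sg1 sg2 /double_pole_sum; ring.
Qed.

(** From [1 / (x (x - y)) = (1 / (x - y) - 1 / x) / y], which lowers the exponent of [x]; the
    Kronecker term repairs the case [x = y], where [0^-1 = 0]. *)
Lemma inv_exprS_sub (x y : R) e : x != 0 -> y != 0 ->
  x^-1 ^+ e.+1 * (x - y)^-1 =
  y^-1 * (x^-1 ^+ e * (x - y)^-1 - x^-1 ^+ e.+1 + x^-1 ^+ e.+1 * (x == y)%:R).
Proof.
move=> x0 y0; have [->|xy] := eqVneq x y.
  by rewrite subrr invr0 !mulr0 sub0r mulr1 addNr mulr0.
rewrite mulr0 addr0 exprS; move: (x^-1 ^+ e) => z.
by field; rewrite x0 y0 subr_eq0 xy.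
Qed.

(** The same identity multiplied by [(x - y)^-1]; both sides now vanish at [x = y]. *)
Lemma inv_exprS_sub2 (x y : R) e : x != 0 -> y != 0 ->
  x^-1 ^+ e.+1 * (x - y)^-1 ^+ 2 =
  y^-1 * (x^-1 ^+ e * (x - y)^-1 ^+ 2 - x^-1 ^+ e.+1 * (x - y)^-1).
Proof.
move=> x0 y0; have [->|xy] := eqVneq x y.
  by rewrite subrr invr0 expr0n !mulr0 subrr mulr0.
rewrite exprS; move: (x^-1 ^+ e) => z.
by field; rewrite x0 y0 subr_eq0 xy.
Qed.

(** Added over [n] and [- n], the bare powers carry the factor [1 + (-1) ^ (e + 1)]: only even
    exponents survive, and the exponent 1, whose power sum may diverge, cancels. *)
Lemma signed_sum1S r e N k : (0 < k <= N)%N ->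
  signed_sum r e.+1 1 N k =
  k%:R^-1 * (signed_sum r e 1 N k - (1 + (- 1) ^+ e.+1) * psum r e.+1 N
             + r ^+ k * k%:R^-1 ^+ e.+1).
Proof.
move=> kN; have k0 : k%:R != 0 :> R.
  by rewrite pnatr_eq0 -lt0n; case/andP: kN.
rewrite -(sum_nat_eq (fun n => r ^+ n * n%:R^-1 ^+ e.+1) kN).
rewrite /psum /signed_sum mulr_sumr -sumrB -big_split /= mulr_sumr.
apply: eq_big_nat => n /andP[n0 _].
have n0' : n%:R != 0 :> R by rewrite pnatr_eq0 -lt0n.
rewrite !expr1 !inv_exprS_sub ?oppr_eq0 //.
have -> : (- n%:R == k%:R :> R)%:R = 0 :> R.
  rewrite eq_sym -subr_eq0 opprK -natrD pnatr_eq0 addn_eq0.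
  by rewrite (gtn_eqF n0) andbF.
by rewrite invrN [(- _^-1) ^+ e.+1]exprNn; ring.
Qed.

Lemma signed_sum2S r e N k : (0 < k <= N)%N ->
  signed_sum r e.+1 2 N k =
  k%:R^-1 * (signed_sum r e 2 N k - signed_sum r e.+1 1 N k).
Proof.
move=> kN; have k0 : k%:R != 0 :> R.
  by rewrite pnatr_eq0 -lt0n; case/andP: kN.
rewrite /signed_sum -sumrB mulr_sumr; apply: eq_big_nat => n /andP[n0 _].
have n0' : n%:R != 0 :> R by rewrite pnatr_eq0 -lt0n.
by rewrite !inv_exprS_sub2 ?oppr_eq0 // !expr1; ring.
Qed.

Lemma psum_pred t p k : (0 < k)%N ->
  psum t p k.-1 = psum t p k - t ^+ k * k%:R^-1 ^+ p.
Proof. by case: k => // k _; rewrite psumS addrK. Qed.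

Lemma sum_neg_shift r b N k : r ^+ 2 = 1 ->
  \sum_(1 <= n < N.+1) r ^+ n * (- n%:R - k%:R)^-1 ^+ b =
  (- 1) ^+ b * (r ^+ k * (psum r b (N + k) - psum r b k)).
Proof.
move=> hr; rewrite -psum_shift // mulr_sumr; apply: eq_bigr => n _.
by rewrite -opprD invrN [(- _^-1) ^+ b]exprNn; ring.
Qed.

(** The blocks up to [k] cancel except for [1 / k]; the outer blocks are arranged as two differences
    that vanish as [N] grows. *)
Lemma signed_sum10 r N k : r ^+ 2 = 1 -> (0 < k <= N)%N ->
  signed_sum r 0 1 N k = k%:R^-1 -
    r ^+ k * ((psum r 1 (N + k) - psum r 1 N) + (psum r 1 N - psum r 1 (N - k))).
Proof.
move=> hr kN; have k0 : (0 < k)%N by case/andP: kN.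
rewrite /signed_sum; under eq_bigr => n _ do rewrite !mul1r mulrDr.
rewrite big_split /= psum_reflect // sum_neg_shift // psum_pred // !expr1.
by have := sign_exprK k hr; move: (r ^+ k) => x hx; ring: hx.
Qed.

(** The sign [(-1) ^ b] is now positive, so the outer blocks add up instead of cancelling. *)
Lemma signed_sum20 r N k : r ^+ 2 = 1 -> (0 < k <= N)%N ->
  signed_sum r 0 2 N k = r ^+ k * (2 * psum r 2 N
    + (psum r 2 (N + k) - psum r 2 N) - (psum r 2 N - psum r 2 (N - k)))
    - k%:R^-1 ^+ 2.
Proof.
move=> hr kN; have k0 : (0 < k)%N by case/andP: kN.
rewrite /signed_sum; under eq_bigr => n _ do rewrite !mul1r mulrDr.
rewrite big_split /= psum_reflect // sum_neg_shift // psum_pred //.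
rewrite sqrrN expr1n.
by have := sign_exprK k hr; move: (r ^+ k) => x hx; ring: hx.
Qed.

(** From [k / (l (k - l)) = 1 / l - 1 / (l - k)], minus the [1 / l] part of the omitted term
    [l = k]. The grouping puts [1 - t ^ k] before [psum t 1 N], which may diverge by itself. *)
Lemma pole_sum_pos t N k : t ^+ 2 = 1 -> (0 < k <= N)%N ->
  k%:R * pole_sum t N k%:R =
  (1 - t ^+ k) * psum t 1 N + t ^+ k * (psum t 1 N - psum t 1 (N - k)) +
  t ^+ k * psum t 1 k - (1 + t ^+ k) * k%:R^-1.
Proof.
move=> ht kN; have k0 : (0 < k)%N by case/andP: kN.
have -> : k%:R * pole_sum t N k%:R = psum t 1 N -
    \sum_(1 <= l < N.+1) t ^+ l * (l%:R - k%:R)^-1 ^+ 1 -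
    \sum_(1 <= l < N.+1) t ^+ l * l%:R^-1 * (l%:R == k%:R :> R)%:R.
  rewrite /psum -!sumrB mulr_sumr; apply: eq_big_nat => l /andP[l0 _].
  have l0' : l%:R != 0 :> R by rewrite pnatr_eq0 -lt0n.
  rewrite !expr1; have [->|lk] := eqVneq l%:R (k%:R : R).
    by rewrite subrr invr0 !mulr0 subr0 mulr1 subrr.
  by rewrite mulr0 subr0; field; rewrite l0' ?subr_eq0 ?lk // eq_sym.
rewrite psum_reflect // (sum_nat_eq (fun l => t ^+ l * l%:R^-1)) // psum_pred //.
rewrite !expr1.
by have := sign_exprK k ht; move: (t ^+ k) => x hx; ring: hx.
Qed.

Lemma pole_sum_neg t N k : t ^+ 2 = 1 -> (0 < k <= N)%N ->
  k%:R * pole_sum t N (- k%:R) =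
  - ((1 - t ^+ k) * psum t 1 N - t ^+ k * (psum t 1 (N + k) - psum t 1 N) +
     t ^+ k * psum t 1 k).
Proof.
move=> ht kN; have k0 : (0 < k)%N by case/andP: kN.
have -> : k%:R * pole_sum t N (- k%:R) =
    - (psum t 1 N - \sum_(1 <= l < N.+1) t ^+ l * (l%:R + k%:R)^-1 ^+ 1).
  rewrite /psum -!sumrB -sumrN mulr_sumr; apply: eq_big_nat => l /andP[l0 _].
  have l0' : l%:R != 0 :> R by rewrite pnatr_eq0 -lt0n.
  have lk : l%:R + k%:R != 0 :> R by rewrite -natrD pnatr_eq0 -lt0n addn_gt0 l0.
  by rewrite !expr1 -opprD addrC; field; rewrite l0' lk.
by rewrite psum_shift //; ring.
Qed.

(** From [k / (l (k - l)^2) = 1 / (l - k)^2 + 1 / (l (k - l))]. *)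
Lemma double_pole_sumE t N k : t ^+ 2 = 1 -> (0 < k <= N)%N ->
  k%:R * double_pole_sum t N k%:R =
  t ^+ k * (psum t 2 N - (psum t 2 N - psum t 2 (N - k)) + psum t 2 k)
  - k%:R^-1 ^+ 2 + k%:R^-1 * (k%:R * pole_sum t N k%:R).
Proof.
move=> ht kN; have k0 : (0 < k)%N by case/andP: kN.
have k0' : k%:R != 0 :> R by rewrite pnatr_eq0 -lt0n.
have -> : k%:R * double_pole_sum t N k%:R =
    \sum_(1 <= l < N.+1) t ^+ l * (l%:R - k%:R)^-1 ^+ 2 + pole_sum t N k%:R.
  rewrite /pole_sum -big_split mulr_sumr; apply: eq_big_nat => l /andP[l0 _] /=.
  have l0' : l%:R != 0 :> R by rewrite pnatr_eq0 -lt0n.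
  have [->|lk] := eqVneq l%:R (k%:R : R).
    by rewrite subrr invr0 expr0n !mulr0 addr0.
  by field; rewrite l0' !subr_eq0 lk eq_sym lk.
rewrite mulKf // psum_reflect // psum_pred // sqrrN expr1n.
by have := sign_exprK k ht; move: (t ^+ k) => x hx; ring: hx.
Qed.

End TwoSidedSums.


(** * Quadratic sums *)

Section QuadraticSums.
Variable R : realType.
Implicit Types (r s t : R) (e : nat).

Lemma dominated_limit_sign t a f (g : nat -> R) : t ^+ 2 = 1 ->
  dominated_limit a f g ->
  dominated_limit a (fun N k => t ^+ k * f N k) (fun k => t ^+ k * g k).
Proof.
by move=> ht; apply: (dominated_limit_scale (C := 1)) => k _; rewrite norm_sign.
Qed.

Lemma dominated_limitV j a f (g : nat -> R) : dominated_limit a f g ->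
  dominated_limit a (fun N k => k%:R^-1 ^+ j * f N k) (fun k => k%:R^-1 ^+ j * g k).
Proof.
apply: (dominated_limit_scale (C := 1)) => k _.
by rewrite natVX_norm exprn_ile1 ?invr_ge0 ?natV_le1.
Qed.

Lemma dominated_limitZ (c : R) a f g : dominated_limit a f g ->
  dominated_limit a (fun N k => c * f N k) (fun k => c * g k).
Proof. exact: (dominated_limit_scale (e := fun=> c) (C := `|c|)). Qed.

Lemma dominated_limitB a f f' (g g' : nat -> R) :
  dominated_limit a f g -> dominated_limit a f' g' ->
  dominated_limit a (fun N k => f N k - f' N k) (fun k => g k - g' k).
Proof.
move=> df df'.
apply: dominated_limit_eq (dominated_limitD df (dominated_limitZ (-1) df')) => *.
  by rewrite mulN1r.
by rewrite mulN1r.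
Qed.

Lemma dominated_limit_psum t p : t ^+ 2 = 1 -> (0 < p)%N ->
  dominated_limit 1 (fun _ k => psum t p k) (psum t p).
Proof.
move=> ht p0; split=> [k _|]; first exact: cvg_cst.
by exists 1 => N k _; rewrite mul1r expr1 psum_le.
Qed.

Lemma dominated_limit_inv j :
  dominated_limit 0 (fun _ k => k%:R^-1 ^+ j) (fun k => k%:R^-1 ^+ j : R).
Proof.
apply: (dominated_limit_cst (C := 1)) => k _.
by rewrite natVX_norm exprn_ile1 ?invr_ge0 ?natV_le1.
Qed.

Lemma psum_dominated_limit t p : t ^+ 2 = 1 -> (1 < p)%N ->
  exists2 z : R, reducible_to_linear z &
    dominated_limit 0 (fun N _ => psum t p N) (fun=> z).
Proof.
move=> ht p1; have [z rz hz] := psum_limit p1 ht; exists z => //.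
split=> [k _ //|]; exists 9 => N k _; rewrite mulr1.
apply: le_trans (ler_norm_sum _ _ _) _.
apply: le_trans (harmonic_sqr_sum_le R N); apply: ler_sum_nat => n /andP[n0 _].
exact: sign_term_le.
Qed.

(** For odd [p], in particular [p = 1], the factor is zero; an even [p] is at least 2 and the series
    converges. *)
Lemma psum_even_limit r p : r ^+ 2 = 1 -> (0 < p)%N ->
  exists2 z : R, reducible_to_linear z &
    dominated_limit 0 (fun N _ => (1 + (- 1) ^+ p) * psum r p N) (fun=> z).
Proof.
move=> hr p0; rewrite -signr_odd; case: (boolP (odd p)) => [_|po].
  exists 0; first exact: (reducible_int R 0).
  have h : dominated_limit 0 (fun _ _ => 0) (fun=> 0 : R).
    by apply: (@dominated_limit_cst _ _ 0) => k _; rewrite normr0.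
  by apply: dominated_limit_eq h => // N k _; rewrite expr1 subrr mul0r.
have p1 : (1 < p)%N by case: p p0 po => [//|[//|p]].
have [z rz hz] := psum_dominated_limit hr p1.
exists (2 * z); first exact: reducibleM (reducible_int R 2) rz.
exact: dominated_limitZ hz.
Qed.

Lemma linear_coef1 : linear_coef (fun=> 1 : R).
Proof. exact: linear_coef_cst (reducible_int R 1). Qed.

(** Induction on [e] through [signed_sum1S]. The limit has to be a multiplier, as it will multiply
    sequences containing harmonic numbers. *)
Lemma signed_sum1_limit r e : r ^+ 2 = 1 ->
  exists2 a : nat -> R, linear_coef a & dominated_limit 1 (signed_sum r e 1) a.
Proof.
move=> hr; elim: e => [|e [a la da]].
  exists (fun k => k%:R^-1 ^+ 1); first exact: linear_coefV.
  have d1 := dominated_limitD (psum_tail_dominated hr (ltn0Sn 0))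
    (psum_head_dominated hr (ltn0Sn 0)).
  have d2 := dominated_limitB (dominated_limitW (leq0n 1) (dominated_limit_inv 1))
    (dominated_limit_sign hr d1).
  apply: dominated_limit_eq d2 => [N k kN|k _]; first by rewrite signed_sum10.
  by rewrite addr0 mulr0 subr0.
have [z rz dz] := psum_even_limit hr (ltn0Sn e).
exists (fun k => k%:R^-1 ^+ 1 * (a k - z + r ^+ k * k%:R^-1 ^+ e.+1)).
  apply: linear_coefM; first exact: linear_coefV.
  apply: linear_coefD; first exact: linear_coefB la (linear_coef_cst rz).
  exact: linear_coefM (linear_coef_sign hr) (linear_coefV _).
have d1 := dominated_limitB da (dominated_limitW (leq0n 1) dz).
have d2 := dominated_limit_sign hr (dominated_limitW (leq0n 1) (dominated_limit_inv e.+1)).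
apply: dominated_limit_eq (dominated_limitV 1 (dominated_limitD d1 d2)) => // N k kN.
by rewrite signed_sum1S.
Qed.

Lemma signed_sum2_limit r e : r ^+ 2 = 1 ->
  exists2 a : nat -> R, linear_coef a & dominated_limit 1 (signed_sum r e 2) a.
Proof.
move=> hr; elim: e => [|e [a la da]].
  have [z rz dz] := psum_dominated_limit hr (ltnSn 1).
  exists (fun k => r ^+ k * (2 * z) - k%:R^-1 ^+ 2).
    apply: linear_coefB (linear_coefV _).
    apply: linear_coefM; first exact: linear_coef_sign.
    exact: linear_coef_cst (reducibleM (reducible_int R 2) rz).
  have d1 := dominated_limitD (dominated_limitW (leq0n 1) (dominated_limitZ 2 dz))
    (psum_tail_dominated hr (ltn0Sn 1)).
  have d2 := dominated_limitB d1 (psum_head_dominated hr (ltn0Sn 1)).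
  have d3 := dominated_limitB (dominated_limit_sign hr d2)
    (dominated_limitW (leq0n 1) (dominated_limit_inv 2)).
  apply: dominated_limit_eq d3 => [N k kN|k _]; first by rewrite signed_sum20.
  by rewrite addr0 subr0.
have [a1 la1 da1] := signed_sum1_limit e.+1 hr.
exists (fun k => k%:R^-1 ^+ 1 * (a k - a1 k)).
  exact: linear_coefM (linear_coefV _) (linear_coefB la la1).
apply: dominated_limit_eq (dominated_limitV 1 (dominated_limitB da da1)) => // N k kN.
by rewrite signed_sum2S.
Qed.

(** The same [a] serves at [k] and at [- k], so that the products at the two points add up to twice
    a quadratic term, up to linear ones. *)
Lemma pole_sum_limit t : t ^+ 2 = 1 -> exists a : nat -> R,
  [/\ linear_coef a,
    dominated_limit 1 (fun N k => k%:R * pole_sum t N k%:R)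
      (fun k => a k + t ^+ k * psum t 1 k - (1 + t ^+ k) * k%:R^-1)
  & dominated_limit 1 (fun N k => - (k%:R * pole_sum t N (- k%:R)))
      (fun k => a k + t ^+ k * psum t 1 k)].
Proof.
move=> ht; have [c rc dc] := alt_psum1_limit ht.
exists (fun k => (1 - t ^+ k) * c).
have dc1 := dominated_limitW (leq0n 1) dc.
have dp := dominated_limit_sign ht (dominated_limit_psum ht (ltn0Sn 0)).
split.
- apply: linear_coefM (linear_coef_cst rc).
  exact: linear_coefB linear_coef1 (linear_coef_sign ht).
- have d1 := dominated_limitD (dominated_limitD dc1
    (dominated_limit_sign ht (psum_head_dominated ht (ltn0Sn 0)))) dp.
  have i1 := dominated_limitW (leq0n 1) (dominated_limit_inv 1).
  have d2 := dominated_limitB d1 (dominated_limitD i1 (dominated_limit_sign ht i1)).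
  apply: dominated_limit_eq d2 => [N k kN|k _].
    by rewrite pole_sum_pos // expr1; ring.
  by rewrite expr1; ring.
- have d1 := dominated_limitD (dominated_limitB dc1
    (dominated_limit_sign ht (psum_tail_dominated ht (ltn0Sn 0)))) dp.
  apply: dominated_limit_eq d1 => [N k kN|k _].
    by rewrite pole_sum_neg // opprK.
  by rewrite mulr0 subr0.
Qed.

Lemma linear_seq_sign_psum t : t ^+ 2 = 1 ->
  linear_seq (fun n => t ^+ n * psum t 1 n).
Proof. by move=> ht; apply: linear_seq_sign => //; exact: linear_seq_psum. Qed.

Lemma linear_coef_diag t : t ^+ 2 = 1 ->
  linear_coef (fun n => (1 + t ^+ n) * n%:R^-1).
Proof.
move=> ht; apply: linear_coefM; last exact: (linear_coefV 1).
exact: linear_coefD linear_coef1 (linear_coef_sign ht).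
Qed.

Lemma pole_sum_pos_limit t : t ^+ 2 = 1 ->
  exists2 g : nat -> R, linear_seq g &
    dominated_limit 1 (fun N k => k%:R * pole_sum t N k%:R) g.
Proof.
move=> ht; have [a [la da _]] := pole_sum_limit ht.
exists (fun k => a k + t ^+ k * psum t 1 k - (1 + t ^+ k) * k%:R^-1) => //.
have l1 := linear_coef_seq (linear_coefB la (linear_coef_diag ht)).
apply: linear_seq_eq (linear_seqD l1 (linear_seq_sign_psum ht)) => n _.
by rewrite addrAC.
Qed.

Lemma double_pole_sum_limit t : t ^+ 2 = 1 ->
  exists2 g : nat -> R, linear_seq g &
    dominated_limit 1 (fun N k => k%:R * double_pole_sum t N k%:R) g.
Proof.
move=> ht; have [g lg dg] := pole_sum_pos_limit ht.
have [z rz dz] := psum_dominated_limit ht (ltnSn 1).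
exists (fun k => t ^+ k * (z - 0 + psum t 2 k) - k%:R^-1 ^+ 2 + k%:R^-1 ^+ 1 * g k).
  apply: linear_seqD; last exact: linear_seqV.
  have lz : linear_seq (fun k => t ^+ k * z - k%:R^-1 ^+ 2).
    apply: linear_coef_seq; apply: linear_coefB (linear_coefV _).
    exact: linear_coefM (linear_coef_sign ht) (linear_coef_cst rz).
  have lp := linear_seq_sign ht (linear_seq_psum (ltn0Sn 1) ht).
  by apply: linear_seq_eq (linear_seqD lz lp) => n _; ring.
have d1 := dominated_limitB (dominated_limitW (leq0n 1) dz) (psum_head_dominated ht (ltn0Sn 1)).
have d2 := dominated_limit_sign ht (dominated_limitD d1 (dominated_limit_psum ht (ltn0Sn 1))).
have d3 := dominated_limitB d2 (dominated_limitW (leq0n 1) (dominated_limit_inv 2)).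
apply: dominated_limit_eq (dominated_limitD d3 (dominated_limitV 1 dg)) => // N k kN.
by rewrite double_pole_sumE.
Qed.

(** Evenness of [e] identifies [(- n)^-e] with [n^-e]. Multiplying each pole sum by [n] or [k] gives
    it growth [H], and leaves the weight [1 / n^2] or [1 / k^2] needed for Tannery's theorem. *)
Lemma pole_sum_mul_normalized r s t e N : ~~ odd e ->
  \sum_(1 <= n < N.+1) (r ^+ n * (n%:R^-1 ^+ e *
     (n%:R * pole_sum s N n%:R * (n%:R * pole_sum t N n%:R) +
      - (n%:R * pole_sum s N (- n%:R)) * - (n%:R * pole_sum t N (- n%:R)))) /
      n%:R ^+ 2) =
  \sum_(1 <= k < N.+1)
    ((s ^+ k * (signed_sum r e 1 N k * (k%:R * pole_sum t N k%:R)) +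
      t ^+ k * (signed_sum r e 1 N k * (k%:R * pole_sum s N k%:R)) +
      s ^+ k * (r ^+ k * (k%:R^-1 ^+ e * (k%:R * double_pole_sum t N k%:R))) +
      t ^+ k * (r ^+ k * (k%:R^-1 ^+ e * (k%:R * double_pole_sum s N k%:R))) +
      s ^+ k * (t ^+ k * signed_sum r e 2 N k)) / k%:R ^+ 2).
Proof.
move=> ee; transitivity (\sum_(1 <= n < N.+1) r ^+ n *
    (n%:R^-1 ^+ e * (pole_sum s N n%:R * pole_sum t N n%:R) +
     (- n%:R)^-1 ^+ e * (pole_sum s N (- n%:R) * pole_sum t N (- n%:R)))).
  apply: eq_big_nat => n /andP[n0 _].
  have n0' : n%:R != 0 :> R by rewrite pnatr_eq0 -lt0n.
  rewrite invrN [(- _^-1) ^+ e]exprNn -signr_odd (negbTE ee) mul1r.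
  by move: (n%:R^-1 ^+ e) => z; field.
rewrite pole_sum_mul; apply: eq_big_nat => k /andP[k0 _].
have k0' : k%:R != 0 :> R by rewrite pnatr_eq0 -lt0n.
by move: (k%:R^-1 ^+ e) => z; field.
Qed.

(** The left truncations give convergence, the right ones the value; the limits agree since the
    truncations do. *)
Lemma reducible_series_transfer f f' (g g' : nat -> R) :
  dominated_limit 2 f g -> dominated_limit 2 f' g' -> linear_seq g' ->
  (forall N, \sum_(1 <= k < N.+1) (f N k / k%:R ^+ 2) =
             \sum_(1 <= k < N.+1) (f' N k / k%:R ^+ 2)) ->
  reducible_series (fun k => g k / k%:R ^+ 2).
Proof.
move=> df df' lg' ff'.
have [cg sg] := dominated_limit_sum df; split=> //.
have [_ sg'] := dominated_limit_sum df'.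
have -> : infinite_sum (fun k => g k / k%:R ^+ 2) =
    infinite_sum (fun k => g' k / k%:R ^+ 2).
  apply: (cvg_unique (@norm_hausdorff _ _) _ sg').
  by apply: cvg_trans sg; apply: near_eq_cvg; near=> N; exact: ff'.
have [_] : reducible_series (fun k => g' k / k%:R ^+ 2); last by [].
apply: reducible_series_eq (lg' 2 1 (ltnSn 1) (sign1 R)) => n _.
by rewrite expr1n mul1r exprVn.
Unshelve. all: by end_near. Qed.

Lemma quadratic_sum_reducible r s t e :
  ~~ odd e -> r ^+ 2 = 1 -> s ^+ 2 = 1 -> t ^+ 2 = 1 ->
  reducible_series
    (fun n => r ^+ n * (psum s 1 n * psum t 1 n) * n%:R^-1 ^+ e.+2).
Proof.
move=> ee hr0 hs ht.
(* The limits of the pole sums bring in [s ^ n * t ^ n]; starting from the weight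
   [(r * (s * t)) ^ n] leaves [r ^ n]. *)
have hr : (r * (s * t)) ^+ 2 = 1 by rewrite !signM.
have [a la da] := signed_sum1_limit e hr.
have [a2 la2 da2] := signed_sum2_limit e hr.
have [gs lgs dgs] := pole_sum_pos_limit hs.
have [gt lgt dgt] := pole_sum_pos_limit ht.
have [hhs lhs dhs] := double_pole_sum_limit hs.
have [hht lht dht] := double_pole_sum_limit ht.
have [cs [lcs dcs dcs']] := pole_sum_limit hs.
have [ct [lct dct dct']] := pole_sum_limit ht.
(* Only the first two summands are products of two factors of growth [H_k], and each pairs a
   multiplier with a linear sequence. *)
have dR := dominated_limitD (dominated_limitD (dominated_limitD (dominated_limitD
  (dominated_limit_sign hs (dominated_limitM da dgt))
  (dominated_limit_sign ht (dominated_limitM da dgs)))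
  (dominated_limit_sign hs (dominated_limit_sign hr (dominated_limitV e
    (dominated_limitW (leqnSn 1) dht)))))
  (dominated_limit_sign ht (dominated_limit_sign hr (dominated_limitV e
    (dominated_limitW (leqnSn 1) dhs)))))
  (dominated_limit_sign hs (dominated_limit_sign ht
    (dominated_limitW (leqnSn 1) da2))).
have lR := linear_seqD (linear_seqD (linear_seqD (linear_seqD
  (linear_seq_sign hs (la _ lgt)) (linear_seq_sign ht (la _ lgs)))
  (linear_seq_sign hs (linear_seq_sign hr (linear_seqV e lht))))
  (linear_seq_sign ht (linear_seq_sign hr (linear_seqV e lhs))))
  (linear_seq_sign hs (linear_seq_sign ht (linear_coef_seq la2))).
have dL := dominated_limit_sign hr (dominated_limitV e (dominated_limitD
  (dominated_limitM dcs dct) (dominated_limitM dcs' dct'))).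
have lim_eq := reducible_series_transfer dL dR lR
  (fun N => pole_sum_mul_normalized _ _ _ N ee).
pose us n : R := (1 + s ^+ n) * n%:R^-1; pose ut n : R := (1 + t ^+ n) * n%:R^-1.
have lus : linear_coef us by exact: linear_coef_diag.
have lut : linear_coef ut by exact: linear_coef_diag.
(* With [S = s ^ n * psum s 1 n] and [T = t ^ n * psum t 1 n], this is what [(cs + S - us) (ct + T -
   ut) + (cs + S) (ct + T)] contains besides [2 S T]. *)
have lin_rest : linear_seq (fun n =>
    (2 * (cs n * ct n) - cs n * ut n - us n * ct n + us n * ut n) +
    (2 * cs n - us n) * (t ^+ n * psum t 1 n) +
    (2 * ct n - ut n) * (s ^+ n * psum s 1 n)).
  have l2 := linear_coef_cst (reducible_int R 2).
  apply: linear_seqD; first apply: linear_seqD.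
  - apply: linear_coef_seq; apply: linear_coefD (linear_coefM lus lut).
    apply: linear_coefB (linear_coefM lus lct).
    exact: linear_coefB (linear_coefM l2 (linear_coefM lcs lct)) (linear_coefM lcs lut).
  - exact: linear_coefB (linear_coefM l2 lcs) lus _ (linear_seq_sign_psum ht).
  - exact: linear_coefB (linear_coefM l2 lct) lut _ (linear_seq_sign_psum hs).
have rest := reducible_seriesZ (reducible_int R (- 1))
  (linear_seqV e lin_rest (ltnSn 1) hr).
apply: reducible_series_eq (reducible_seriesZ (reducible_inv2 R) (reducible_seriesD lim_eq rest)).
move=> n n0.
have n0' : n%:R != 0 :> R by rewrite pnatr_eq0 -lt0n.
rewrite /us /ut -exprVn !exprMn [_ ^+ e.+2]exprSr [_ ^+ e.+1]exprSr.
have hx := sign_exprK n hs; have hy := sign_exprK n ht.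
move: (s ^+ n) (t ^+ n) hx hy => x y hx hy.
rewrite mulrN1z; move: (n%:R^-1 ^+ e) => z; move: n%:R^-1 => w.
by field: hx hy.
Qed.

(** Odd indices cancel, and the index [2 j] contributes [1 / j]. *)
Lemma psum_add_alt n :
  psum 1 1 n.*2.+1 + psum (- 1) 1 n.*2.+1 = harmonic_number n :> R.
Proof.
rewrite !psumS psum1E psum_alt_double expr1n.
by rewrite sign_doubleS; ring.
Qed.

(* Writing [M = 2 n + 1], the harmonic number [H_n] is [H_M - L_M(1)]. *)
Lemma odd_harmonic_sqr_reducible e : ~~ odd e ->
  reducible_series (fun n : nat =>
    (harmonic_number n : R) ^+ 2 / (2 * n + 1)%:R ^+ e.+2).
Proof.
(* The factor [(1 - (-1) ^ M) / 2] selects the odd [M]. *)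
move=> ee; pose G M : R := 2^-1 * ((1 - (- 1) ^+ M) *
  (psum 1 1 M + psum (- 1) 1 M) ^+ 2 * M%:R^-1 ^+ e.+2).
have q r s t := @quadratic_sum_reducible r s t e ee.
have p1 := sign1 R; have m1 := signN1 R.
have [cG rG] : reducible_series G.
  have part r : r ^+ 2 = 1 -> reducible_series (fun M =>
      r ^+ M * (psum 1 1 M + psum (- 1) 1 M) ^+ 2 * M%:R^-1 ^+ e.+2).
    move=> hr; apply: reducible_series_eq (reducible_seriesD (reducible_seriesD
      (q r _ _ hr p1 p1) (reducible_seriesZ (reducible_int R 2) (q r _ _ hr p1 m1)))
      (q r _ _ hr m1 m1)) => n _.
    by move: (n%:R^-1 ^+ e.+2) (r ^+ n) => z w; ring.
  apply: reducible_seriesZ (reducible_inv2 R) _.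
  apply: reducible_series_eq (reducible_seriesD (part _ p1)
    (reducible_seriesZ (reducible_int R (- 1)) (part _ m1))) => n _.
  rewrite expr1n mulrN1z.
  by move: (n%:R^-1 ^+ e.+2) ((- 1) ^+ n) => z w; ring.
(* The odd [M < 2 N] correspond to [0 <= n < N]; the extra term [n = 0], that is [M = 1], is
   zero. *)
have partial N : \sum_(1 <= M < N.*2) G M =
    \sum_(1 <= n < N) ((harmonic_number n : R) ^+ 2 / (2 * n + 1)%:R ^+ e.+2).
  elim: N => [|[|N] IH]; first by rewrite !big_geq.
    rewrite big_nat1 big_geq // /G /psum !big_nat1 !expr1.
    by rewrite invr1 !mulr1 subrr expr0n mulr0 mul0r mulr0.
  rewrite doubleS big_nat_recr //= big_nat_recr //= IH.
  rewrite [RHS]big_nat_recr //= -addrA; congr (_ + _).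
  rewrite {1}/G sign_double subrr !mul0r mulr0 add0r.
  rewrite /G psum_add_alt sign_doubleS opprK mul2n addn1 exprVn.
  by field; rewrite expf_neq0 // pnatr_eq0.
have lim : \sum_(1 <= n < N) ((harmonic_number n : R) ^+ 2 / (2 * n + 1)%:R ^+ e.+2)
    @[N --> \oo] --> infinite_sum G.
  rewrite -(funext partial).
  exact: (cvg_comp _ _ cvg_double (infinite_sumP cG)).
by split; [apply/cvg_ex; exists (infinite_sum G)|rewrite (infinite_sum_eq lim)].
Qed.

End QuadraticSums.

(** * The seven sums as signed quadratic sums *)

Theorem theorem3p5 (R : realType) (m : nat) (hm : (1 <= m)%N) :
  reducible_series (fun n : nat =>
    (alt_partial n 1 : R) ^+ 2 / n%:R ^+ (2 * m) * (-1) ^+ n.-1) /\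
  reducible_series (fun n : nat =>
    (harmonic_number n : R) * alt_partial n 1 / n%:R ^+ (2 * m)) /\
  reducible_series (fun n : nat =>
    (harmonic_number n : R) * alt_partial n 1 / n%:R ^+ (2 * m)
      * (-1) ^+ n.-1) /\
  reducible_series (fun n : nat =>
    (harmonic_number n : R) ^+ 2 / n%:R ^+ (2 * m)) /\
  reducible_series (fun n : nat =>
    (harmonic_number n : R) ^+ 2 / n%:R ^+ (2 * m) * (-1) ^+ n.-1) /\
  reducible_series (fun n : nat =>
    (alt_partial n 1 : R) ^+ 2 / n%:R ^+ (2 * m)) /\
  reducible_series (fun n : nat =>
    (harmonic_number n : R) ^+ 2 / (2 * n + 1)%:R ^+ (2 * m)).
Proof.
(* This puts the exponent in the form [e + 2] with [e = 2 (m - 1)] even. *)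
have -> : (2 * m = (2 * m.-1).+2)%N by case: m hm => // m _; rewrite mulnS.
have ee : ~~ odd (2 * m.-1) by rewrite oddM.
move: (2 * m.-1)%N ee => e ee.
have q r s t := @quadratic_sum_reducible R r s t e ee.
have p1 := sign1 R; have m1 := signN1 R.
have rN1 : reducible_to_linear (- 1 : R) by exact: (reducible_int R (- 1)).
have H n : harmonic_number n = psum 1 1 n :> R by rewrite psum1E.
(* Each [L_n(1)] and each factor [(-1) ^ (n - 1)] costs one sign; an odd total accounts for the
   multiplications by [-1] below. *)
have L n : alt_partial n 1 = - psum (- 1) 1 n :> R by rewrite psumN1_alt opprK.
have sgn n : (0 < n)%N -> (- 1) ^+ n.-1 = - (- 1) ^+ n :> R.
  by case: n => // n _; rewrite exprS mulN1r opprK.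
split; [|split; [|split; [|split; [|split; [|split]]]]].
- apply: reducible_series_eq (reducible_seriesZ rN1 (q _ _ _ m1 m1 m1)) => n n0.
  by rewrite L sgn // exprVn; ring.
- apply: reducible_series_eq (reducible_seriesZ rN1 (q _ _ _ p1 p1 m1)) => n n0.
  by rewrite H L exprVn expr1n; ring.
- apply: reducible_series_eq (q _ _ _ m1 p1 m1) => n n0.
  by rewrite H L sgn // exprVn; ring.
- apply: reducible_series_eq (q _ _ _ p1 p1 p1) => n n0.
  by rewrite H exprVn expr1n; ring.
- apply: reducible_series_eq (reducible_seriesZ rN1 (q _ _ _ m1 p1 p1)) => n n0.
  by rewrite H sgn // exprVn; ring.
- apply: reducible_series_eq (q _ _ _ p1 m1 m1) => n n0.
  by rewrite L exprVn expr1n; ring.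
- exact: odd_harmonic_sqr_reducible.
Qed.
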